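(* Let $\mathbf C$ be a metric logical category, with canonical language and theory $(\mathscr L_{\mathbf C},T_{\mathbf C})$. Then there is an equivalence of categories $$\mathrm{Mod}^*(\mathscr L_{\mathbf C},T_{\mathbf C})\;\simeq\;\hom^*(\mathbf C,\mathbf{Met}),$$ where $\mathrm{Mod}^*(\mathscr L_{\mathbf C},T_{\mathbf C})$ is the category of models of $T_{\mathbf C}$ in $\mathbf{Met}$ with elementary maps, and $\hom^*(\mathbf C,\mathbf{Met})$ is the category of logical functors $\mathbf C\to\mathbf{Met}$ with logical transformations as morphisms.
   Context: Continuous logic. A continuous language $\mathscr L$ consists of sorts, finitary relation symbols $R\subseteq S_1\times\cdots\times S_n$ and finitary function symbols $f:S_1\times\cdots\times S_n\to S$ (0-ary ones are constants), with variables of every sort. Terms are built from variables and function symbols. Formulas are built from atomic formulas $R(t_1,\dots,t_n)$ by connectives $u(\varphi_1,\dots,\varphi_n)$, one for each continuous $u:[0,1]^n\to[0,1]$, $n\ge 0$, and quantifiers $\forall_{\bar x}\varphi$, $\exists_{\bar x}\varphi$ over finite tuples of variables. A sentence is a formula without free variables; a theory is a set of sentences. A ($[0,1]$-valued) $\mathscr L$-structure $M$ assigns a set $M(S)$ to each sort, a function to each function symbol, and a function $M(R):\prod M(S_i)\to[0,1]$ to each relation symbol; terms and connectives are interpreted by composition, $\forall$ as $\sup$ and $\exists$ as $\inf$. The value $0$ is truth: $M\models\varphi(\bar x)$ iff $M(\varphi)(\bar a)=0$ for all $\bar a$. Write $x\dotminus y=\max\{x-y,0\}$; $\varphi\le r$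 abbreviates $\varphi\dotminus r$, and an implication $\varphi<\delta\Rightarrow\psi\le\varepsilon$ says that whenever $\varphi$ has value $<\delta$, $\psi$ has value $\le\varepsilon$. $T\models\varphi$ means every structure satisfying $T$ satisfies $\varphi$. A continuous logical algebra is an algebra having an $n$-ary operation for each continuous $u:[0,1]^n\to[0,1]$ ($n\ge0$) and satisfying all equations true in $[0,1]$; it is ordered by $x\le y$ iff $x=\min(x,y)$. It is standard if $a\le\varepsilon$ for all constants $\varepsilon>0$ implies $a=0$. $\mathbf{CLA}$ is the category of these algebras and homomorphisms. A continuous syntactic category is a category $\mathbf C$ with finite products and a contravariant functor $\mathbf L:\mathbf C\to\mathbf{CLA}$ such that (1) $\mathbf L(1)$ is standard for $1$ the empty product; (2) for each projection $\pi:A\times B\to B$, $\mathbf L(\pi):\mathbf L(B)\to\mathbf L(A\times B)$ is an embedding with a left adjoint $\forall_\pi:\mathbf L(A\times B)\to\mathbf L(B)$ preserving constants and order: $\forall_\pi(g)\le h$ iff $g\le\mathbf L(\pi)(h)$. Put $\exists_\pi(g)=1\dotminus\forall_\pi(1\dotminus g)$. A structure $M:\mathscr L\to\mathbf C$ assigns to each sort $S$ an object $M(S)$, to each $f:S_1\times\cdots\times S_n\to S$ a morphism $M(f):\prod M(S_i)\to M(S)$, to each $R\subseteq S_1\times\cdots\times S_n$ an element $M(R)\in\mathbf L(\prod M(S_i))$. For a tuple of variables $\bar x$, $M(\bar x)$ is the product of the objects assigned to their sorts. Terms are interpreted as morphisms by composition; $M(R(t_1,\dots,t_n))=\mathbf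 L((M(t_1),\dots,M(t_n)))(M(R))$; connectives are interpreted by the algebra operations; quantifiers over $\bar x$ in $\varphi(\bar x,\bar y)$ by $\forall_\pi,\exists_\pi$ for the projection $\pi:M(\bar x)\times M(\bar y)\to M(\bar y)$. $M\models\varphi(\bar x)$ iff $M(\varphi)=0$ in $\mathbf L(M(\bar x))$. A model of $T$ in $\mathbf C$, written $M:(\mathscr L,T)\to\mathbf C$, is a structure satisfying all of $T$. An elementary map $h:M\to N$ between models in $\mathbf C$ is a family of morphisms $h_S:M(S)\to N(S)$ with $M(\varphi)=\mathbf L(h_{\bar x})(N(\varphi))$ for every formula $\varphi(\bar x)$, $h_{\bar x}$ being the product of the relevant $h_S$. Canonical language: $\mathscr L_{\mathbf C}$ has a sort $S_A$ for each object $A$, a relation symbol $R_\varphi$ with domain $S_A$ for each $\varphi\in\mathbf L(A)$, and a function symbol $f_\alpha:S_A\to S_B$ for each morphism $\alpha:A\to B$. When $A=A_1\times\cdots\times A_n$, such symbols are also used with domain $S_{A_1}\times\cdots\times S_{A_n}$. The canonical structure $M_{\mathbf C}:\mathscr L_{\mathbf C}\to\mathbf C$ interprets each symbol as the datum it comes from, and $T_{\mathbf C}$ is the set of sentences $\varphi$ with $M_{\mathbf C}(\varphi)=0$. An element $d\in\mathbf L(B\times B)$ is a pseudo-metric on $B$ if, in $M_{\mathbf C}$, $d(x,x)=0$, $d(x,y)=d(y,x)$ and $d(x,y)+d(y,z)\ge d(x,z)$. A metric logical category is a continuous syntactic category with a pseudo-metric $d_B$ assigned to each object $B$ such that: (1)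 each morphism $\alpha:A\to B$ is uniformly continuous (for every $\varepsilon>0$ there is $\delta>0$ with $T_{\mathbf C}\models d_A(x,y)<\delta\Rightarrow d_B(f_\alpha(x),f_\alpha(y))\le\varepsilon$), and each $b\in\mathbf L(B)$ is uniformly continuous (for every $\varepsilon>0$ there is $\delta>0$ with $T_{\mathbf C}\models d_B(x,y)<\delta\Rightarrow|R_b(x)-R_b(y)|\le\varepsilon$); (2) for $\alpha,\beta:A\to B$, if $T_{\mathbf C}\models d_B(f_\alpha(x),f_\beta(x))$ then $\alpha=\beta$. The element $d_A$ provides the metric symbol on the sort $S_A$ of $\mathscr L_{\mathbf C}$. When interpreting a metric language in a metric logical category, the metric symbol of a sort $S$ must be interpreted as $d_{M(S)}$. $\mathbf{Met}$ is the category of metric spaces with metric bounded by 1 and uniformly continuous maps; it is a metric logical category with $\mathbf L(X)$ the algebra of uniformly continuous functions $X\to[0,1]$, $\mathbf L(\alpha)$ composition with $\alpha$, $\forall_\pi$ the supremum over fibres, and $d_X$ the metric of $X$. A logical functor $(\mathbf R,\mathbf L_{\mathbf R})\to(\mathbf S,\mathbf L_{\mathbf S})$ is a pair $(I,i)$ with $I:\mathbf R\to\mathbf S$ a product-preserving functor and $i:\mathbf L_{\mathbf R}\to\mathbf L_{\mathbf S}\circ I$ a natural transformation such that each $i_A:\mathbf L_{\mathbf R}(A)\to\mathbf L_{\mathbf S}(I(A))$ is an embedding of continuous logical algebras and $i$ carries $d_A$ to $d_{I(A)}$ for each object $A$. A logical transformation $(F,i_F)\to(G,i_G)$ between logical functors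 $\mathbf R\to\mathbf S$ is a pair $(\eta,\epsilon)$ of natural transformations $\eta:F\to G$ and $\epsilon:\mathbf L_{\mathbf S}\circ G\to\mathbf L_{\mathbf S}\circ F$ such that $i_{F,A}=\epsilon_A\circ i_{G,A}$ for every object $A$ of $\mathbf R$.
   Formalization: Logical functors must also commute with quantifiers, and the i_A are required to be embeddings only if every element of L(1) is a constant; logical transformations have ε = L(η); spaces in Met are nonempty. With the literal definitions the claim is false. *)

(* Defs.v *)
From HB Require Import structures.
From mathcomp Require Import all_boot all_order all_algebra.
From mathcomp Require Import ring lra.
From mathcomp Require Import all_classical all_reals all_analysis.
Import Order.TTheory GRing.Theory Num.Def Num.Theory.
Import numFieldNormedType.Exports.

Set Implicit Arguments.
Unset Strict Implicit.
Unset Printing Implicit Defensive.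

Local Open Scope classical_set_scope.
Local Open Scope ring_scope.

#[local] Obligation Tactic := idtac.

Record category := Category {
  ob :> Type;
  hom : ob -> ob -> Type;
  idm : forall a, hom a a;
  comp : forall a b c, hom b c -> hom a b -> hom a c;
  comp_idl : forall a b (f : hom a b), comp (idm b) f = f;
  comp_idr : forall a b (f : hom a b), comp f (idm a) = f;
  compA : forall a b c d (h : hom c d) (g : hom b c) (f : hom a b),
    comp h (comp g f) = comp (comp h g) f }.
Arguments hom {c0} : rename.
Arguments idm {c0} : rename.
Arguments comp {c0 a b c} : rename.

Definition is_iso (C : category) (a b : C) (f : hom a b) : Prop :=
  exists g : hom b a, comp g f = idm a /\ comp f g = idm b.

Program Definition opp_cat (C : category) : category := {|
  ob := ob C;
  hom := fun a b => @hom C b a;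
  idm := fun a => idm a;
  comp := fun a b c f g => comp g f |}.
Next Obligation. by move=> C a b f; exact: comp_idr. Qed.
Next Obligation. by move=> C a b f; exact: comp_idl. Qed.
Next Obligation. by move=> C a b c d h g f; exact: esym (compA _ _ _). Qed.

Record functor (C D : category) := Functor {
  fob :> C -> D;
  fmap : forall a b, hom a b -> hom (fob a) (fob b);
  fmap_id : forall a, fmap (idm a) = idm (fob a);
  fmap_comp : forall a b c (g : hom b c) (f : hom a b),
    fmap (comp g f) = comp (fmap g) (fmap f) }.
Arguments fmap {C D} f0 {a b} : rename.

Program Definition functor_id (C : category) : functor C C :=
  {| fob := fun a => a; fmap := fun a b f => f |}.
Next Obligation. by []. Qed.
Next Obligation. by []. Qed.

Program Definition functor_comp (C D E : category)
    (G : functor D E) (F : functor C D) : functor C E :=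
  {| fob := fun a => G (F a); fmap := fun a b f => fmap G (fmap F f) |}.
Next Obligation. by move=> C D E G F a /=; rewrite !fmap_id. Qed.
Next Obligation. by move=> C D E G F a b c g f /=; rewrite !fmap_comp. Qed.

Program Definition functor_opp (C D : category) (F : functor C D) :
    functor (opp_cat C) (opp_cat D) :=
  {| fob := fun a : opp_cat C => F a : opp_cat D;
     fmap := fun a b f => @fmap C D F b a f |}.
Next Obligation. by move=> C D F a; exact: fmap_id. Qed.
Next Obligation. by move=> C D F a b c g f; exact: fmap_comp. Qed.

Record nat_trans (C D : category) (F G : functor C D) := NatTrans {
  component :> forall a, hom (F a) (G a);
  naturality : forall a b (f : hom a b),
    comp (component b) (fmap F f) = comp (fmap G f) (component a) }.

Lemma nat_trans_ext (C D : category) (F G : functor C D)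
  (s t : nat_trans F G) : (forall a, s a = t a) -> s = t.
Proof.
case: s t => [s hs] [t ht] /= st.
have e : s = t by apply: functional_extensionality_dep.
by rewrite {}e in hs *; congr NatTrans; exact: Prop_irrelevance.
Qed.

Program Definition nat_id (C D : category) (F : functor C D) :
  nat_trans F F := {| component := fun a => idm (F a) |}.
Next Obligation. by move=> C D F a b f /=; rewrite comp_idl comp_idr. Qed.

Program Definition nat_comp (C D : category) (F G H : functor C D)
    (t : nat_trans G H) (s : nat_trans F G) : nat_trans F H :=
  {| component := fun a => comp (t a) (s a) |}.
Next Obligation.
by move=> C D F G H t s a b f /=; rewrite -compA naturality compA naturality compA.
Qed.

Definition nat_isomorphic (C D : category) (F G : functor C D) : Prop :=
  exists s : nat_trans F G, forall a, is_iso (s a).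

Definition equivalent_categories (C D : category) : Prop :=
  exists (F : functor C D) (G : functor D C),
    nat_isomorphic (functor_comp G F) (functor_id C) /\
    nat_isomorphic (functor_comp F G) (functor_id D).

Program Definition full_subcategory (C : category) (P : C -> Prop) : category :=
  {| ob := {a : C | P a};
     hom := fun a b => hom (sval a) (sval b);
     idm := fun a => idm (sval a);
     comp := fun a b c g f => comp g f |}.
Next Obligation. by move=> C P a b f; exact: comp_idl. Qed.
Next Obligation. by move=> C P a b f; exact: comp_idr. Qed.
Next Obligation. by move=> C P a b c d h g f; exact: compA. Qed.

Record finite_products (C : category) := FiniteProducts {
  fp_one : C;
  fp_bang : forall a, hom a fp_one;
  fp_bang_uniq : forall a (f : hom a fp_one), f = fp_bang a;
  fp_prod : C -> C -> C;
  fp_fst : forall a b, hom (fp_prod a b) a;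
  fp_snd : forall a b, hom (fp_prod a b) b;
  fp_pair : forall x a b, hom x a -> hom x b -> hom x (fp_prod a b);
  fp_fst_pair : forall x a b (f : hom x a) (g : hom x b),
    comp (fp_fst a b) (fp_pair f g) = f;
  fp_snd_pair : forall x a b (f : hom x a) (g : hom x b),
    comp (fp_snd a b) (fp_pair f g) = g;
  fp_pair_uniq : forall x a b (h : hom x (fp_prod a b)),
    h = fp_pair (comp (fp_fst a b) h) (comp (fp_snd a b) h) }.

Section UnitInterval.
Variable R : realType.

Record I01 := MkI01 { I01val :> R; I01P : 0 <= I01val <= (1 : R) }.
HB.instance Definition _ := [isSub for I01val].
HB.instance Definition _ := [Choice of I01 by <:].

Let I01dist (x y : I01) : R := `|(x : R) - (y : R)|.

Lemma I01distxx x : I01dist x x = 0.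
Proof. by rewrite /I01dist subrr normr0. Qed.

Lemma I01dist_pos x y : I01dist x y = 0 -> x = y.
Proof. by move/eqP; rewrite normr_eq0 subr_eq0 => /eqP /val_inj. Qed.

Lemma I01dist_sym x y : I01dist x y = I01dist y x.
Proof. by rewrite /I01dist distrC. Qed.

Lemma I01dist_tri y x z : I01dist x z <= I01dist x y + I01dist y z.
Proof. exact: ler_distD. Qed.

HB.instance Definition _ := @isMetric.Build R I01 I01dist
  I01distxx I01dist_pos I01dist_sym I01dist_tri.

Lemma I01_0P : 0 <= (0 : R) <= 1. Proof. by rewrite lexx ler01. Qed.
Lemma I01_1P : 0 <= (1 : R) <= 1. Proof. by rewrite lexx ler01. Qed.
Definition I01_0 := MkI01 I01_0P.
Definition I01_1 := MkI01 I01_1P.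
HB.instance Definition _ := isPointed.Build I01 I01_0.

Lemma ballI01E (x y : I01) (e : R) : ball x e y = (`|(x : R) - (y : R)| < e).
Proof. by rewrite ballEmdist. Qed.

Record connective (n : nat) := Connective {
  conn_fun :> 'rV[I01]_n -> I01;
  conn_continuous : continuous conn_fun }.

Definition conn_apply n (u : connective n) (x : 'I_n -> I01) : I01 :=
  u (\row_i x i).

Fact rV_I01_continuous n (u : 'rV[I01]_n -> I01) (k : R) :
  (forall (x y : 'rV[I01]_n) (d : R), (forall i, `|(x ord0 i : R) - (y ord0 i : R)| < d) ->
    `|(u x : R) - (u y : R)| <= k * d) -> continuous u.
Proof.
move=> uL x A /nbhs_ballP[e /= e0 eA].
have k0 : 0 < `|k| + 1 by rewrite ltr_wpDl.
have d0 : 0 < e / (`|k| + 1) by rewrite divr_gt0.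
apply/nbhs_ballP; exists (e / (`|k| + 1)) => // y [_ xy] /=.
apply: eA; rewrite ballI01E; apply: le_lt_trans (uL _ _ (e / (`|k| + 1)) _) _.
  by move=> i; move: (xy ord0 i); rewrite ballI01E.
rewrite mulrCA gtr_pMr// ltr_pdivrMr// mul1r.
by rewrite (le_lt_trans (ler_norm _))// ltrDl.
Qed.

Definition conn_const (r : I01) : connective 0.
Proof. by exists (fun _ => r); exact: cst_continuous. Defined.

Definition pair2 (X : Type) (a b : X) (i : 'I_2) : X :=
  if i == ord0 then a else b.

Lemma pair2_comp (X Y : Type) (f : X -> Y) (a b : X) :
  (fun i => f (pair2 a b i)) = pair2 (f a) (f b).
Proof. by apply/funext => i; rewrite /pair2; case: ifP. Qed.

Definition empty_fun (X : Type) (i : 'I_0) : X :=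
  match i with Ordinal _ h => False_rect X (notF h) end.

Lemma empty_funE (X : Type) (f : 'I_0 -> X) : f = @empty_fun X.
Proof. by apply/funext => -[]. Qed.

Definition lipschitz2 (f : I01 -> I01 -> R) :=
  (forall x y, 0 <= f x y <= 1) /\
  (forall x y x' y', `|f x y - f x' y'| <= `|(x : R) - (x' : R)| + `|(y : R) - (y' : R)|).

Definition conn2 (f : I01 -> I01 -> R) (hf : lipschitz2 f) : connective 2.
Proof.
exists (fun v => MkI01 (hf.1 (v ord0 ord0) (v ord0 ord_max))).
apply: (@rV_I01_continuous _ _ 2) => x y d xy /=.
apply: le_trans (hf.2 _ _ _ _) _.
by rewrite mulrDl mul1r lerD// ltW.
Defined.

Lemma conn2E f (hf : lipschitz2 f) (x y : I01) :
  conn_apply (conn2 hf) (pair2 x y) = MkI01 (hf.1 x y).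
Proof. by apply: val_inj; rewrite /conn_apply /= !mxE. Qed.

Lemma lipschitz2I (f : I01 -> I01 -> R) (g : R -> R -> R) :
  (forall x y, f x y = g x y) ->
  (forall x y, 0 <= x <= 1 -> 0 <= y <= 1 -> 0 <= g x y <= 1) ->
  (forall x y x' y' p q, x <= x' + p -> x' <= x + p -> y <= y' + q ->
     y' <= y + q -> g x y <= g x' y' + (p + q)) -> lipschitz2 f.
Proof.
move=> fg g01 gl; split=> [x y|x y x' y']; first by rewrite fg g01 ?I01P.
have H (u v : R) : u <= v + `|u - v| by rewrite -lerBlDl ler_norm.
rewrite !fg ler_norml; apply/andP; split; last by rewrite lerBlDl gl// distrC.
by rewrite lerNl opprB lerBlDl; apply: gl => //; rewrite distrC.
Qed.

Ltac minmax_lra := move=> *; rewrite /Num.min /Num.max;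
  repeat case: ltP => ?; try (apply/andP; split); lra.

Fact min_lipschitz2 : lipschitz2 (fun x y => Num.min (x : R) (y : R)).
Proof. by apply: (@lipschitz2I _ Num.min) => // *; minmax_lra. Qed.
Fact dotminus_lipschitz2 :
  lipschitz2 (fun x y => Num.max ((x : R) - (y : R)) 0).
Proof. by apply: (@lipschitz2I _ (fun x y => Num.max (x - y) 0)) => // *; minmax_lra. Qed.
Fact plus_lipschitz2 : lipschitz2 (fun x y => Num.min ((x : R) + (y : R)) 1).
Proof. by apply: (@lipschitz2I _ (fun x y => Num.min (x + y) 1)) => // *; minmax_lra. Qed.
Fact absdiff_lipschitz2 :
  lipschitz2 (fun x y => Num.max ((x : R) - (y : R)) ((y : R) - (x : R))).
Proof. by apply: (@lipschitz2I _ (fun x y => Num.max (x - y) (y - x))) => // *; minmax_lra. Qed.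

Definition conn_min : connective 2 := conn2 min_lipschitz2.
Definition conn_dotminus : connective 2 := conn2 dotminus_lipschitz2.
Definition conn_plus : connective 2 := conn2 plus_lipschitz2.
Definition conn_absdiff : connective 2 := conn2 absdiff_lipschitz2.

End UnitInterval.

Section ContinuousLogicalAlgebras.
Variable R : realType.

Inductive cla_term : Type :=
| cla_var of nat
| cla_app n of connective R n & ('I_n -> cla_term).

Fixpoint cla_eval (X : Type)
    (op : forall n, connective R n -> ('I_n -> X) -> X) (v : nat -> X)
    (t : cla_term) : X :=
  match t with
  | cla_var k => v k
  | cla_app n u ts => op n u (fun i => cla_eval op v (ts i))
  end.

Definition cla_identity (t s : cla_term) : Prop :=
  forall v : nat -> I01 R,
    cla_eval (@conn_apply R) v t = cla_eval (@conn_apply R) v s.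

Record cla := Cla {
  cla_sort :> Type;
  cla_op : forall n, connective R n -> ('I_n -> cla_sort) -> cla_sort;
  cla_identities : forall t s, cla_identity t s ->
    forall v : nat -> cla_sort, cla_eval cla_op v t = cla_eval cla_op v s }.

Definition cla_const (X : cla) (r : I01 R) : X :=
  cla_op (conn_const r) (@empty_fun X).
Definition cla_op2 (X : cla) (u : connective R 2) (a b : X) : X :=
  cla_op u (pair2 a b).
(* 0 is truth, so that [sc_all] below, the left adjoint, is a supremum. *)
Definition cla_le (X : cla) (a b : X) : Prop := a = cla_op2 (conn_min R) a b.

Definition cla_standard (X : cla) : Prop :=
  forall a : X, (forall e : I01 R, 0 < (e : R) -> cla_le a (cla_const X e)) ->
    a = cla_const X (I01_0 R).

Record cla_hom (X Y : cla) := ClaHom {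
  cla_fun :> X -> Y;
  cla_hom_op : forall n (u : connective R n) (x : 'I_n -> X),
    cla_fun (cla_op u x) = cla_op u (fun i => cla_fun (x i)) }.

Lemma cla_hom_ext (X Y : cla) (f g : cla_hom X Y) : f =1 g -> f = g.
Proof.
case: f g => [f hf] [g hg] /= /funext fg.
by rewrite {}fg in hf *; congr ClaHom; exact: Prop_irrelevance.
Qed.

Program Definition cla_hom_id (X : cla) : cla_hom X X :=
  {| cla_fun := fun x => x |}.
Next Obligation. by []. Qed.

Program Definition cla_hom_comp (X Y Z : cla) (g : cla_hom Y Z)
    (f : cla_hom X Y) : cla_hom X Z := {| cla_fun := fun x => g (f x) |}.
Next Obligation. by move=> X Y Z g f n u x /=; rewrite !cla_hom_op. Qed.

Program Definition CLA : category :=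
  {| ob := cla; hom := cla_hom; idm := cla_hom_id; comp := cla_hom_comp |}.
Next Obligation. by move=> X Y f; exact: cla_hom_ext. Qed.
Next Obligation. by move=> X Y f; exact: cla_hom_ext. Qed.
Next Obligation. by move=> X Y Z T h g f; exact: cla_hom_ext. Qed.

Lemma cla_hom_const (X Y : cla) (f : cla_hom X Y) r :
  f (cla_const X r) = cla_const Y r.
Proof. by rewrite cla_hom_op; congr cla_op; exact: empty_funE. Qed.

Lemma cla_hom_op2 (X Y : cla) (f : cla_hom X Y) u a b :
  f (cla_op2 u a b) = cla_op2 u (f a) (f b).
Proof. by rewrite cla_hom_op pair2_comp. Qed.

End ContinuousLogicalAlgebras.
Arguments cla_const {R X}.

Record syntactic_category (R : realType) := SyntacticCategory {
  sc_cat :> category;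
  sc_prod : finite_products sc_cat;
  sc_L : functor (opp_cat sc_cat) (CLA R);
  sc_one_standard : cla_standard (sc_L (fp_one sc_prod));
  sc_snd_inj : forall a b : sc_cat,
    injective (fmap sc_L (fp_snd sc_prod a b : @hom (opp_cat sc_cat) b _));
  sc_all : forall a b : sc_cat, sc_L (fp_prod sc_prod a b) -> sc_L b;
  sc_all_adjoint : forall (a b : sc_cat) g h,
    cla_le (sc_all (a := a) (b := b) g) h <->
    cla_le g (fmap sc_L (fp_snd sc_prod a b : @hom (opp_cat sc_cat) b _) h);
  sc_all_const : forall (a b : sc_cat) r,
    sc_all (a := a) (b := b) (cla_const r) = cla_const r;
  sc_all_le : forall (a b : sc_cat) g h, cla_le g h ->
    cla_le (sc_all (a := a) (b := b) g) (sc_all h) }.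

Section SyntacticCategory.
Variables (R : realType) (C : syntactic_category R).

Definition one : C := fp_one (sc_prod C).
Definition bang (a : C) : hom a one := fp_bang (sc_prod C) a.
Definition prd (a b : C) : C := fp_prod (sc_prod C) a b.
Definition pr1 (a b : C) : hom (prd a b) a := fp_fst (sc_prod C) a b.
Definition pr2 (a b : C) : hom (prd a b) b := fp_snd (sc_prod C) a b.
Definition pairm (x a b : C) (f : hom x a) (g : hom x b) : hom x (prd a b) :=
  fp_pair (sc_prod C) f g.
Definition prdm (a b a' b' : C) (f : hom a a') (g : hom b b') :
    hom (prd a b) (prd a' b') :=
  pairm (comp f (pr1 a b)) (comp g (pr2 a b)).

Definition LL (a : C) : cla R := sc_L C a.
Definition pull (a b : C) (f : hom a b) : cla_hom (LL b) (LL a) :=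
  fmap (sc_L C) (f : @hom (opp_cat C) b a).

Definition alle (a b : C) (g : LL (prd a b)) : LL b := sc_all g.
Definition exe (a b : C) (g : LL (prd a b)) : LL b :=
  cla_op2 (conn_dotminus R) (cla_const (I01_1 R))
    (alle (cla_op2 (conn_dotminus R) (cla_const (I01_1 R)) g)).

Lemma bangE (a : C) (f : hom a one) : f = bang a.
Proof. exact: fp_bang_uniq. Qed.
Lemma pr1_pair (x a b : C) (f : hom x a) (g : hom x b) :
  comp (pr1 a b) (pairm f g) = f.
Proof. exact: fp_fst_pair. Qed.
Lemma pr2_pair (x a b : C) (f : hom x a) (g : hom x b) :
  comp (pr2 a b) (pairm f g) = g.
Proof. exact: fp_snd_pair. Qed.
Lemma pairmE (x a b : C) (h : hom x (prd a b)) :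
  h = pairm (comp (pr1 a b) h) (comp (pr2 a b) h).
Proof. exact: fp_pair_uniq. Qed.
Lemma pull_id (a : C) (x : LL a) : pull (idm a) x = x.
Proof. by rewrite /pull (fmap_id (sc_L C) a). Qed.
Lemma pull_comp (a b c : C) (g : hom b c) (f : hom a b) (x : LL c) :
  pull (comp g f) x = pull f (pull g x).
Proof. by rewrite /pull (fmap_comp (sc_L C) (_ : @hom (opp_cat C) b a)). Qed.
Lemma prdm_id (a b : C) : prdm (idm a) (idm b) = idm (prd a b).
Proof. by rewrite [RHS]pairmE /prdm !comp_idl !comp_idr. Qed.
Lemma prdm_comp (a b a' b' a'' b'' : C) (f' : hom a' a'') (g' : hom b' b'')
    (f : hom a a') (g : hom b b') :
  prdm (comp f' f) (comp g' g) = comp (prdm f' g') (prdm f g).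
Proof.
rewrite [RHS]pairmE; congr pairm.
  by rewrite [RHS]compA pr1_pair -[RHS]compA pr1_pair compA.
by rewrite [RHS]compA pr2_pair -[RHS]compA pr2_pair compA.
Qed.

End SyntacticCategory.
Arguments one {R} C.
Arguments bang {R C} a.
Arguments alle {R C a b}.
Arguments exe {R C a b}.

(* A finite tuple of sorts, kept as a bracketed expression, so that the product
   it denotes in a category is an iterated binary product.  It serves both as
   the domain of a symbol and as the tuple of sorts of a tuple of variables. *)
Inductive ctx (S : Type) : Type :=
| cnil
| cone of S
| ccat of ctx S & ctx S.
Arguments cnil {S}.

Fixpoint pos (S : Type) (G : ctx S) : Type :=
  match G with
  | cnil => void
  | cone _ => unit
  | ccat G1 G2 => pos G1 + pos G2
  end.

Fixpoint sort_at (S : Type) (G : ctx S) : pos G -> S :=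
  match G return pos G -> S with
  | cnil => fun p => match p with end
  | cone s => fun=> s
  | ccat G1 G2 => fun p =>
      match p with inl q => sort_at q | inr q => sort_at q end
  end.

Record language := Language {
  lsort : Type;
  lfun : Type;
  lfun_dom : lfun -> ctx lsort;
  lfun_cod : lfun -> lsort;
  lrel : Type;
  lrel_dom : lrel -> ctx lsort }.

Inductive term (L : language) (G : ctx (lsort L)) : lsort L -> Type :=
| tvar (p : pos G) : term G (sort_at p)
| tapp (f : lfun L) :
    (forall q : pos (lfun_dom f), term G (sort_at q)) -> term G (lfun_cod f).

(* [formula R G] : formulas whose free variables are those of the tuple [G];
   [fall D] and [fex D] bind the tuple of variables [D]. *)
Inductive formula (R : realType) (L : language) : ctx (lsort L) -> Type :=
| frel G (r : lrel L) :
    (forall q : pos (lrel_dom r), term G (sort_at q)) -> formula R G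
| fconn G n (u : connective R n) : ('I_n -> formula R G) -> formula R G
| fall D G : formula R (ccat D G) -> formula R G
| fex D G : formula R (ccat D G) -> formula R G.

Definition fconn2 (R : realType) (L : language) (G : ctx (lsort L))
    (u : connective R 2) (phi psi : formula R G) : formula R G :=
  fconn u (pair2 phi psi).

Definition theory (R : realType) (L : language) := formula R (@cnil (lsort L)) -> Prop.

Section Structures.
Variables (R : realType) (L : language).

(* sup and inf are taken in the complete lattice [0,1], so that the empty
   family has sup 0 and inf 1. *)
Definition range01 (T : Type) (f : T -> I01 R) : set R :=
  [set r | exists t, r = I01val (f t)].

Lemma sup01P (T : Type) (f : T -> I01 R) :
  0 <= sup (0 |` range01 f) <= 1.
Proof.
apply/andP; split.
  apply: ub_le_sup; last by left.
  by exists 1 => r [->|[t ->]]; [exact: ler01 | case/andP: (I01P (f t))].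
apply: ge_sup; first by exists 0; left.
by move=> r [->|[t ->]]; [exact: ler01 | case/andP: (I01P (f t))].
Qed.

Lemma inf01P (T : Type) (f : T -> I01 R) :
  0 <= inf (1 |` range01 f) <= 1.
Proof.
apply/andP; split.
  apply: lb_le_inf; first by exists 1; left.
  by move=> r [->|[t ->]]; [exact: ler01 | case/andP: (I01P (f t))].
apply: ge_inf; last by left.
by exists 0 => r [->|[t ->]]; [exact: ler01 | case/andP: (I01P (f t))].
Qed.

Definition sup01 (T : Type) (f : T -> I01 R) : I01 R := MkI01 (sup01P f).
Definition inf01 (T : Type) (f : T -> I01 R) : I01 R := MkI01 (inf01P f).

Definition env (car : lsort L -> Type) (G : ctx (lsort L)) : Type :=
  forall p : pos G, car (sort_at p).

Definition env_cat (car : lsort L -> Type) (D G : ctx (lsort L))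
    (a : env car D) (b : env car G) : env car (ccat D G) :=
  fun p => match p with inl q => a q | inr q => b q end.

Record structure01 := Structure01 {
  s01_car : lsort L -> Type;
  s01_fun : forall f : lfun L,
    env s01_car (lfun_dom f) -> s01_car (lfun_cod f);
  s01_rel : forall r : lrel L, env s01_car (lrel_dom r) -> I01 R }.

Fixpoint term01 (M : structure01) G s (t : term G s)
    (a : env (s01_car M) G) : s01_car M s :=
  match t with
  | tvar p => a p
  | tapp f ts => s01_fun (fun q => term01 (ts q) a)
  end.

Fixpoint value01 (M : structure01) G (phi : formula R G) :
    env (s01_car M) G -> I01 R :=
  match phi with
  | frel _ r ts => fun a => s01_rel (fun q => term01 (ts q) a)
  | fconn _ n u phis => fun a => conn_apply u (fun i => value01 (phis i) a)
  | fall _ _ psi => fun a => sup01 (fun b => value01 psi (env_cat b a))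
  | fex _ _ psi => fun a => inf01 (fun b => value01 psi (env_cat b a))
  end.

Definition models01 (M : structure01) G (phi : formula R G) : Prop :=
  forall a, value01 (M := M) phi a = I01_0 R.

Definition models01_theory (M : structure01) (T : theory R L) : Prop :=
  forall phi, T phi -> models01 M phi.

Definition entails (T : theory R L) G (phi : formula R G) : Prop :=
  forall M : structure01, models01_theory M T -> models01 M phi.

Definition entails_lt_le (T : theory R L) G (phi : formula R G) (delta : R)
    (psi : formula R G) (eps : R) : Prop :=
  forall M : structure01, models01_theory M T -> forall a,
    (value01 (M := M) phi a : R) < delta -> (value01 (M := M) psi a : R) <= eps.

End Structures.

Section CategoricalStructures.
Variables (R : realType) (C : syntactic_category R).

Fixpoint ctx_ob (S : Type) (o : S -> C) (G : ctx S) : C :=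
  match G with
  | cnil => one C
  | cone s => o s
  | ccat G1 G2 => prd (ctx_ob o G1) (ctx_ob o G2)
  end.

Fixpoint ctx_proj (S : Type) (o : S -> C) (G : ctx S) :
    forall p : pos G, hom (ctx_ob o G) (o (sort_at p)) :=
  match G return forall p : pos G, hom (ctx_ob o G) (o (sort_at p)) with
  | cnil => fun p => match p with end
  | cone s => fun _ => idm (o s)
  | ccat G1 G2 => fun p =>
      match p with
      | inl q => comp (ctx_proj o q) (pr1 (ctx_ob o G1) (ctx_ob o G2))
      | inr q => comp (ctx_proj o q) (pr2 (ctx_ob o G1) (ctx_ob o G2))
      end
  end.

Fixpoint ctx_tuple (S : Type) (o : S -> C) (x : C) (G : ctx S) :
    (forall p : pos G, hom x (o (sort_at p))) -> hom x (ctx_ob o G) :=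
  match G return (forall p : pos G, hom x (o (sort_at p))) -> hom x (ctx_ob o G)
  with
  | cnil => fun _ => bang x
  | cone s => fun h => h tt
  | ccat G1 G2 => fun h =>
      pairm (ctx_tuple (fun q => h (inl q))) (ctx_tuple (fun q => h (inr q)))
  end.

Fixpoint ctx_map (S : Type) (o o' : S -> C) (h : forall s, hom (o s) (o' s))
    (G : ctx S) : hom (ctx_ob o G) (ctx_ob o' G) :=
  match G return hom (ctx_ob o G) (ctx_ob o' G) with
  | cnil => idm (one C)
  | cone s => h s
  | ccat G1 G2 => prdm (ctx_map h G1) (ctx_map h G2)
  end.

Lemma ctx_map_id (S : Type) (o : S -> C) G :
  ctx_map (fun s => idm (o s)) G = idm (ctx_ob o G).
Proof. by elim: G => //= G1 -> G2 ->; rewrite prdm_id. Qed.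

Lemma ctx_map_comp (S : Type) (o o' o'' : S -> C)
    (h' : forall s, hom (o' s) (o'' s)) (h : forall s, hom (o s) (o' s)) G :
  ctx_map (fun s => comp (h' s) (h s)) G = comp (ctx_map h' G) (ctx_map h G).
Proof. by elim: G => [|s|G1 IH1 G2 IH2] //=; rewrite ?comp_idl // IH1 IH2 prdm_comp. Qed.

Variable L : language.

Record structure := Structure {
  str_ob : lsort L -> C;
  str_fun : forall f : lfun L,
    hom (ctx_ob str_ob (lfun_dom f)) (str_ob (lfun_cod f));
  str_rel : forall r : lrel L, LL (ctx_ob str_ob (lrel_dom r)) }.

Fixpoint term_mor (M : structure) G s (t : term G s) :
    hom (ctx_ob (str_ob M) G) (str_ob M s) :=
  match t with
  | tvar p => ctx_proj (str_ob M) p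
  | tapp f ts => comp (str_fun M f) (ctx_tuple (fun q => term_mor M (ts q)))
  end.

Fixpoint interp (M : structure) G (phi : formula R G) :
    LL (ctx_ob (str_ob M) G) :=
  match phi with
  | frel _ r ts => pull (ctx_tuple (fun q => term_mor M (ts q))) (str_rel M r)
  | fconn _ n u phis => cla_op u (fun i => interp M (phis i))
  | fall _ _ psi => alle (interp M psi)
  | fex _ _ psi => exe (interp M psi)
  end.

Definition models (M : structure) G (phi : formula R G) : Prop :=
  interp M phi = cla_const (I01_0 R).

Definition models_theory (M : structure) (T : theory R L) : Prop :=
  forall phi, T phi -> models M phi.

End CategoricalStructures.

Section Canonical.
Variables (R : realType) (C : syntactic_category R).

(* There is one symbol for each datum on A and each expression of A as a product
   A_1 x ... x A_n; the symbol with domain S_A is the case n = 1. *)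
Record canonical_fun := CanonicalFun {
  cf_dom : ctx C;
  cf_cod : C;
  cf_mor : hom (ctx_ob (fun a : C => a) cf_dom) cf_cod }.

Record canonical_rel := CanonicalRel {
  cr_dom : ctx C;
  cr_elt : LL (ctx_ob (fun a : C => a) cr_dom) }.

Definition canonical_language : language :=
  {| lsort := C; lfun := canonical_fun; lfun_dom := cf_dom; lfun_cod := cf_cod;
     lrel := canonical_rel; lrel_dom := cr_dom |}.

Definition canonical_structure : structure C canonical_language :=
  {| str_ob := fun a : lsort canonical_language => a;
     str_fun := cf_mor; str_rel := cr_elt |}.

Definition canonical_theory : theory R canonical_language :=
  fun phi => models canonical_structure phi.

Definition fun_app (a b : C) (f : hom a b) (G : ctx C)
    (t : @term canonical_language G a) : @term canonical_language G b :=
  @tapp canonical_language G (@CanonicalFun (cone a) b f) (fun=> t).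

Definition rel_app (a : C) (x : LL a) (G : ctx C)
    (t : @term canonical_language G a) : @formula R canonical_language G :=
  @frel R canonical_language G (@CanonicalRel (cone a) x) (fun=> t).

Definition rel_app2 (a : C) (x : LL (prd a a)) (G : ctx C)
    (t s : @term canonical_language G a) : @formula R canonical_language G :=
  @frel R canonical_language G (@CanonicalRel (ccat (cone a) (cone a)) x)
    (fun q => match q with inl _ => t | inr _ => s end).

Definition ctx2 (a : C) : ctx C := ccat (cone a) (cone a).
Definition ctx3 (a : C) : ctx C := ccat (cone a) (ctx2 a).

Definition var1 (a : C) : @term canonical_language (cone a) a :=
  @tvar canonical_language (cone a) tt.
Definition var2_x (a : C) : @term canonical_language (ctx2 a) a :=
  @tvar canonical_language (ctx2 a) (inl tt).
Definition var2_y (a : C) : @term canonical_language (ctx2 a) a :=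
  @tvar canonical_language (ctx2 a) (inr tt).
Definition var3_x (a : C) : @term canonical_language (ctx3 a) a :=
  @tvar canonical_language (ctx3 a) (inl tt).
Definition var3_y (a : C) : @term canonical_language (ctx3 a) a :=
  @tvar canonical_language (ctx3 a) (inr (inl tt)).
Definition var3_z (a : C) : @term canonical_language (ctx3 a) a :=
  @tvar canonical_language (ctx3 a) (inr (inr tt)).

(* An equality (inequality) of values is rendered by the formula
   |phi - psi| (phi -. psi), which is true exactly when it holds. *)
Definition pseudo_metric (b : C) (d : LL (prd b b)) : Prop :=
  [/\ models canonical_structure (rel_app2 d (var1 b) (var1 b)),
      models canonical_structure (fconn2 (conn_absdiff R)
        (rel_app2 d (var2_x b) (var2_y b)) (rel_app2 d (var2_y b) (var2_x b))) &
      models canonical_structure (fconn2 (conn_dotminus R)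
        (rel_app2 d (var3_x b) (var3_z b))
        (fconn2 (conn_plus R) (rel_app2 d (var3_x b) (var3_y b))
                              (rel_app2 d (var3_y b) (var3_z b))))].

End Canonical.

Record metric_logical_category (R : realType) := MetricLogicalCategory {
  mlc_cat :> syntactic_category R;
  mlc_dist : forall a : mlc_cat, LL (prd a a);
  mlc_dist_pseudo_metric : forall a, pseudo_metric (mlc_dist a);
  mlc_hom_unif : forall (a b : mlc_cat) (f : hom a b) (e : R), 0 < e ->
    exists2 d : R, 0 < d &
      entails_lt_le (canonical_theory (C := mlc_cat))
        (rel_app2 (mlc_dist a) (var2_x a) (var2_y a)) d
        (rel_app2 (mlc_dist b) (fun_app f (var2_x a)) (fun_app f (var2_y a))) e;
  mlc_elt_unif : forall (b : mlc_cat) (x : LL b) (e : R), 0 < e ->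
    exists2 d : R, 0 < d &
      entails_lt_le (canonical_theory (C := mlc_cat))
        (rel_app2 (mlc_dist b) (var2_x b) (var2_y b)) d
        (fconn2 (conn_absdiff R) (rel_app x (var2_x b)) (rel_app x (var2_y b))) e;
  mlc_hom_separated : forall (a b : mlc_cat) (f g : hom a b),
    entails (canonical_theory (C := mlc_cat))
      (rel_app2 (mlc_dist b) (fun_app f (var1 a)) (fun_app g (var1 a))) ->
    f = g }.
Arguments mlc_dist {R m} a : rename.

Section ProductMetric.
Variables (R : realType) (X Y : metricType R).

Let prod_mdist (p q : X * Y) : R := Num.max (mdist p.1 q.1) (mdist p.2 q.2).

Let prod_mdist_ge0 p q : 0 <= prod_mdist p q.
Proof. by rewrite le_max mdist_ge0. Qed.

Let prod_mdist_pos p q : prod_mdist p q = 0 -> p = q.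
Proof.
case: p q => [x y] [x' y'] pq0; congr pair; apply: mdist_positivity;
  apply: le_anti; rewrite mdist_ge0 andbT -pq0 le_max /= lexx ?orbT //.
Qed.

Let prod_ballE p d : ball p d = [set q | prod_mdist p q < d].
Proof.
apply/seteqP; split=> q; rewrite /= gt_max.
  by case; rewrite !ballEmdist => -> ->.
by move=> /andP[p1 p2]; split; rewrite ballEmdist.
Qed.

HB.instance Definition _ := @PseudoMetric_isMetric.Build R (X * Y)%type
  prod_mdist prod_mdist_ge0 prod_mdist_pos prod_ballE.

Lemma mdist_prodE (p q : X * Y) :
  mdist p q = Num.max (mdist p.1 q.1) (mdist p.2 q.2).
Proof. by []. Qed.

End ProductMetric.

Section UnitMetric.
Variable R : realType.

Definition point : Type := unit.
HB.instance Definition _ := Choice.on point.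

Let point_mdist (p q : point) : R := 0.
Let point_mdistxx p : point_mdist p p = 0. Proof. by []. Qed.
Let point_mdist_pos p q : point_mdist p q = 0 -> p = q.
Proof. by case: p; case: q. Qed.
Let point_mdist_sym p q : point_mdist p q = point_mdist q p. Proof. by []. Qed.
Let point_mdist_tri q p r : point_mdist p r <= point_mdist p q + point_mdist q r.
Proof. by rewrite /point_mdist addr0. Qed.

HB.instance Definition _ := @isMetric.Build R point point_mdist
  point_mdistxx point_mdist_pos point_mdist_sym point_mdist_tri.

End UnitMetric.

Section MetricSpaces.
Variable R : realType.

(* Spaces are nonempty: for empty X, the map L(Y) -> L(X x Y) induced by the
   projection would not be an embedding. *)
Record met_space := MetSpace {
  ms_type :> metricType R;
  ms_bounded : forall x y : ms_type, mdist x y <= 1;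
  ms_inhabited : inhabited ms_type }.

Record met_map (X Y : metricType R) := MetMap {
  mm_fun :> X -> Y;
  mm_unif : unif_continuous mm_fun }.

Lemma met_map_ext (X Y : metricType R) (f g : met_map X Y) : f =1 g -> f = g.
Proof.
case: f g => [f hf] [g hg] /= /funext fg.
by rewrite {}fg in hf *; congr MetMap; exact: Prop_irrelevance.
Qed.

Lemma unif_mdistP (X Y : metricType R) (f : X -> Y) :
  unif_continuous f <-> forall e : R, 0 < e -> exists2 d : R, 0 < d &
    forall x y, mdist x y < d -> mdist (f x) (f y) < e.
Proof.
rewrite unif_continuousP; split=> H e e0; have [d d0 D] := H e e0; exists d => //.
  by move=> x y xy; have := D (x, y); rewrite !ballEmdist /=; apply.
by move=> [x y]; rewrite !ballEmdist /=; exact: D.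
Qed.

Program Definition met_id (X : metricType R) : met_map X X :=
  {| mm_fun := fun x => x |}.
Next Obligation. by move=> X; apply/unif_mdistP => e e0; exists e. Qed.

Program Definition met_comp (X Y Z : metricType R) (g : met_map Y Z)
    (f : met_map X Y) : met_map X Z := {| mm_fun := fun x => g (f x) |}.
Next Obligation.
move=> X Y Z g f; apply/unif_mdistP => e e0.
have [d d0 D] := (unif_mdistP g).1 (mm_unif g) e e0.
have [c c0 F] := (unif_mdistP f).1 (mm_unif f) d d0.
by exists c => // x y /F /D.
Qed.

Program Definition Met_cat : category :=
  {| ob := met_space; hom := fun X Y : met_space => met_map X Y;
     idm := fun X : met_space => met_id X;
     comp := fun (X Y Z : met_space) g f => met_comp g f |}.
Next Obligation. by move=> X Y f; exact: met_map_ext. Qed.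
Next Obligation. by move=> X Y f; exact: met_map_ext. Qed.
Next Obligation. by move=> X Y Z T h g f; exact: met_map_ext. Qed.

Program Definition met_point : met_space := {| ms_type := point |}.
Next Obligation. by move=> x y; exact: ler01. Qed.
Next Obligation. exact: (inhabits tt). Qed.

Program Definition met_prod (X Y : met_space) : met_space :=
  {| ms_type := (X * Y)%type |}.
Next Obligation. by move=> X Y p q; rewrite mdist_prodE ge_max !ms_bounded. Qed.
Next Obligation.
by move=> X Y; case: (ms_inhabited X) => x; case: (ms_inhabited Y) => y.
Qed.

Program Definition met_bang (X : met_space) : met_map X met_point :=
  {| mm_fun := fun _ => tt : met_point |}.
Next Obligation. by move=> X; apply/unif_mdistP => e e0; exists 1. Qed.

Program Definition met_fst (X Y : met_space) : met_map (met_prod X Y) X :=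
  {| mm_fun := fun p : met_prod X Y => p.1 |}.
Next Obligation.
move=> X Y; apply/unif_mdistP => e e0; exists e => // p q.
by rewrite mdist_prodE gt_max => /andP[].
Qed.

Program Definition met_snd (X Y : met_space) : met_map (met_prod X Y) Y :=
  {| mm_fun := fun p : met_prod X Y => p.2 |}.
Next Obligation.
move=> X Y; apply/unif_mdistP => e e0; exists e => // p q.
by rewrite mdist_prodE gt_max => /andP[].
Qed.

Program Definition met_pair (Z X Y : met_space) (f : met_map Z X)
    (g : met_map Z Y) : met_map Z (met_prod X Y) :=
  {| mm_fun := fun z => (f z, g z) : met_prod X Y |}.
Next Obligation.
move=> Z X Y f g; apply/unif_mdistP => e e0.
have [d d0 D] := (unif_mdistP f).1 (mm_unif f) e e0.
have [c c0 F] := (unif_mdistP g).1 (mm_unif g) e e0.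
exists (Num.min c d); first by rewrite lt_min c0.
move=> x y; rewrite lt_min => /andP[/F gxy /D fxy].
by rewrite mdist_prodE gt_max fxy.
Qed.

Program Definition Met_products : finite_products Met_cat :=
  {| fp_one := met_point : Met_cat; fp_bang := met_bang;
     fp_prod := met_prod : Met_cat -> Met_cat -> Met_cat;
     fp_fst := met_fst; fp_snd := met_snd; fp_pair := met_pair |}.
Next Obligation. by move=> X f; apply: met_map_ext => x; case: (f x). Qed.
Next Obligation. by move=> *; exact: met_map_ext. Qed.
Next Obligation. by move=> *; exact: met_map_ext. Qed.
Next Obligation. by move=> Z X Y h; apply: met_map_ext => z /=; case: (h z). Qed.

Lemma compact_I01 : compact [set: I01 R].
Proof.
have P (r : R) : 0 <= Num.max 0 (Num.min r 1) <= 1.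
  by rewrite le_max lexx /= ge_max ler01 ge_min lexx orbT.
have -> : [set: I01 R] = (fun r : R => MkI01 (P r)) @` `[0, 1]%classic.
  apply/seteqP; split=> // -[r r01] _; exists r; first by rewrite /= in_itv.
  apply: val_inj => /=; case/andP: r01 => r0 r1.
  by rewrite min_l// max_r.
apply: continuous_compact; last exact: segment_compact.
apply: continuous_subspaceT => r A /nbhs_ballP[e /= e0 eA].
apply/nbhs_ballP; exists e => // s rs; apply: eA; rewrite ballI01E /=.
apply: le_lt_trans rs; rewrite ler_norml.
have L (a b p : R) : a <= b + p -> 0 <= p ->
    Num.max 0 (Num.min a 1) <= Num.max 0 (Num.min b 1) + p.
  move=> ab p0; rewrite ge_max; apply/andP; split.
    by rewrite addr_ge0// le_max lexx.
  rewrite addr_maxl le_max; apply/orP; right; rewrite addr_minl le_min.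
  by rewrite !ge_min ab /= lerDl p0 orbT.
have D (a b : R) : a <= b + `|a - b| by rewrite -lerBlDl ler_norm.
rewrite lerNl opprB !lerBlDl !L//.
by rewrite distrC.
Qed.

Lemma connective_unif n (u : connective R n) (e : R) : 0 < e ->
  exists2 d : R, 0 < d & forall x y : 'I_n -> I01 R,
    (forall i, mdist (x i) (y i) < d) ->
    mdist (conn_apply u x) (conn_apply u y) < e.
Proof.
move=> e0.
have K : compact [set: 'rV[I01 R]_n].
  have := @rV_compact (I01 R) n (fun=> setT) (fun=> compact_I01).
  by congr compact; apply/seteqP; split.
have NC := (compact_near_coveringP _).1 K R (0^'+) (fun d (x : 'rV[I01 R]_n) =>
  forall y : 'rV[I01 R]_n, (forall i, mdist (x ord0 i) (y ord0 i) < d) ->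
    mdist (u x) (u y) < e) _.
have {}NC := NC (at_right_proper_filter (0 : R)).
have /NC : forall x : 'rV[I01 R]_n, [set: 'rV[I01 R]_n] x ->
    \forall x' \near x & d \near (0 : R)^'+, (fun (x' : 'rV[I01 R]_n) (d : R) =>
    forall y : 'rV[I01 R]_n,
    (forall i, mdist (x' ord0 i) (y ord0 i) < d) -> mdist (u x') (u y) < e) x' d.
  move=> x _.
  have e20 : 0 < e / 2 by rewrite divr_gt0.
  have /nbhs_ballP[d /= d0 D] : nbhs x [set y | ball (u x) (e / 2) (u y)].
    by apply: (@conn_continuous _ _ u x _); exact: nbhsx_ballx.
  have d20 : 0 < d / 2 by rewrite divr_gt0.
  exists (ball x (d / 2), [set c | c < d / 2]).
    by split; [exact: nbhsx_ballx | exact: nbhs_right_lt].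
  move=> [x' c] [/= [_ xx'] cd] y x'y.
  have := D y; have := D x'; rewrite /= !ballEmdist /= => H1 H2.
  have {}H1 : mdist (u x) (u x') < e / 2.
    apply: H1; split=> // i j; have := xx' i j; rewrite !ballEmdist /= => h.
    by apply: lt_trans h _; rewrite gtr_pMr// invf_lt1// ltr1n.
  have {}H2 : mdist (u x) (u y) < e / 2.
    apply: H2; split=> // i j; have := xx' i j; rewrite !ballEmdist /= => h.
    apply: le_lt_trans (metric_triangle _ (x' i j) _) _.
    rewrite [ltRHS](splitr d) ltrD//; rewrite (ord1 i).
    by apply: lt_trans (x'y j) cd.
  apply: le_lt_trans (metric_triangle _ (u x) _) _.
  by rewrite [ltRHS](splitr e) ltrD// metric_sym.
move=> N; have [d [d0 D]] : exists d : R, 0 < d /\ forall x y : 'rV[I01 R]_n,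
    (forall i, mdist (x ord0 i) (y ord0 i) < d) -> mdist (u x) (u y) < e.
  near (0 : R)^'+ => d; exists d; split; first by [].
  by move=> x; move: x (I : [set: 'rV[I01 R]_n] x); near: d; exact: N.
exists d => // x y xy; apply: D => i.
by rewrite !mxE.
Unshelve. all: by end_near. Qed.

Local Notation I01 := (I01 R).

Lemma I01_ge0 (x : I01) : 0 <= (x : R).
Proof. by case/andP: (I01P x). Qed.

Lemma I01_le1 (x : I01) : (x : R) <= 1.
Proof. by case/andP: (I01P x). Qed.

Lemma val_sup01_ub (T : Type) (f : T -> I01) t : (f t : R) <= (sup01 f : R).
Proof.
apply: ub_le_sup; last by right; exists t.
by exists 1 => r [->|[s ->]]; [exact: ler01 | case/andP: (I01P (f s))].
Qed.

Lemma val_sup01_le (T : Type) (f : T -> I01) (r : R) : 0 <= r ->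
  (forall t, (f t : R) <= r) -> (sup01 f : R) <= r.
Proof.
move=> r0 fr; apply: ge_sup; first by exists 0; left.
by move=> s [->|[t ->]].
Qed.

Lemma val_inf01_lb (T : Type) (f : T -> I01) t : (inf01 f : R) <= (f t : R).
Proof.
apply: ge_inf; last by right; exists t.
by exists 0 => r [->|[s ->]]; [exact: ler01 | case/andP: (I01P (f s))].
Qed.

Lemma val_inf01_ge (T : Type) (f : T -> I01) (r : R) : r <= 1 ->
  (forall t, r <= (f t : R)) -> r <= (inf01 f : R).
Proof.
move=> r1 fr; apply: lb_le_inf; first by exists 1; left.
by move=> s [->|[t ->]].
Qed.

Lemma mdistI01E (x y : I01) : mdist x y = `|(x : R) - (y : R)|.
Proof. by []. Qed.

Program Definition UC_op (X : metricType R) n (u : connective R n)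
    (f : 'I_n -> met_map X I01) : met_map X I01 :=
  {| mm_fun := fun x => conn_apply u (fun i => f i x) |}.
Next Obligation.
move=> X n u f; apply/unif_mdistP => e e0.
have [d d0 D] := connective_unif u e0.
have H i : exists c : R, 0 < c /\
    forall x y, mdist x y < c -> mdist (f i x) (f i y) < d.
  by have [c c0 C] := (unif_mdistP (f i)).1 (mm_unif (f i)) d d0; exists c.
have [c C] := choice H.
exists (\big[Num.min/1]_i c i).
  by elim/big_ind: _ => // [a b a0 b0|i _]; [rewrite lt_min a0 | case: (C i)].
move=> x y xy; apply: D => i; apply: (C i).2; apply: lt_le_trans xy _.
exact: bigmin_le_cond.
Qed.

Lemma UC_eval (X : metricType R) (v : nat -> met_map X I01) t x :
  cla_eval (@UC_op X) v t x = cla_eval (@conn_apply R) (fun k => v k x) t.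
Proof.
elim: t => //= n u ts IH; congr conn_apply; exact/funext.
Qed.

Program Definition UC (X : metricType R) : cla R :=
  {| cla_sort := met_map X I01; cla_op := @UC_op X |}.
Next Obligation.
by move=> X t s ts v; apply: met_map_ext => x; rewrite !UC_eval ts.
Qed.

Lemma UC_constE (X : metricType R) r (x : X) :
  (cla_const r : UC X) x = r.
Proof. by []. Qed.

Lemma UC_op2E (X : metricType R) u (f g : UC X) x :
  (cla_op2 u f g) x = conn_apply u (pair2 (f x) (g x)).
Proof.
rewrite /cla_op2 /= /conn_apply; congr (conn_fun u _).
by apply/rowP => i; rewrite !mxE /pair2; case: ifP.
Qed.

Lemma UC_leP (X : metricType R) (f g : UC X) :
  cla_le f g <-> forall x, (f x : R) <= (g x : R).
Proof.
split=> [fg x|fg].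
  rewrite {1}fg UC_op2E conn2E /= ge_min lexx orbT //.
apply: met_map_ext => x; rewrite UC_op2E conn2E; apply: val_inj => /=.
by rewrite min_l.
Qed.

Program Definition UC_map (X Y : metricType R) (f : met_map X Y) :
    cla_hom (UC Y) (UC X) :=
  {| cla_fun := fun g : UC Y => met_comp g f : UC X |}.
Next Obligation. by move=> X Y f n u x; exact: met_map_ext. Qed.

Program Definition Met_L : functor (opp_cat Met_cat) (CLA R) :=
  {| fob := fun X : opp_cat Met_cat => UC (X : met_space) : CLA R;
     fmap := fun (X Y : opp_cat Met_cat) (f : hom X Y) =>
       UC_map (f : met_map (Y : met_space) (X : met_space)) |}.
Next Obligation. by move=> X; apply: cla_hom_ext => g; exact: met_map_ext. Qed.
Next Obligation.
by move=> X Y Z g f; apply: cla_hom_ext => h; exact: met_map_ext.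
Qed.

Program Definition UC_all (X Y : met_space) (f : UC (met_prod X Y)) : UC Y :=
  {| mm_fun := fun y => sup01 (fun x : X => f (x, y)) |}.
Next Obligation.
move=> X Y f; apply/unif_mdistP => e e0.
have e20 : 0 < e / 2 by rewrite divr_gt0.
have [d d0 D] := (unif_mdistP f).1 (mm_unif f) _ e20.
have H (y z : Y) : mdist y z < d -> (sup01 (fun x : X => f (x, y)) : R) <=
    (sup01 (fun x : X => f (x, z)) : R) + e / 2.
  move=> yz; apply: val_sup01_le => [|x].
    by apply: addr_ge0; [exact: I01_ge0 | exact: ltW].
  apply: le_trans (lerD (val_sup01_ub (fun x : X => f (x, z)) x) (lexx _)).
  rewrite -lerBlDl; apply: le_trans (ler_norm _) _; rewrite -mdistI01E; apply: ltW.
  by apply: D; rewrite mdist_prodE mdistxx gt_max d0.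
exists d => // y z yz; rewrite mdistI01E; apply: (@le_lt_trans _ _ (e / 2)); last first.
  by rewrite gtr_pMr// invf_lt1// ltr1n.
by rewrite ler_norml lerNl opprB !lerBlDl !H// metric_sym.
Qed.

Program Definition Met_sc : syntactic_category R :=
  {| sc_cat := Met_cat; sc_prod := Met_products; sc_L := Met_L;
     sc_all := UC_all |}.
Next Obligation.
move=> f fe; apply: met_map_ext => x; apply: val_inj => /=.
apply: le_anti; rewrite I01_ge0 andbT.
apply/ler_addgt0Pl => e e0; rewrite addr0.
have [e1|/ltW e1] := leP e 1; last first.
  by apply: le_trans e1; exact: I01_le1.
have h : 0 <= e <= 1 by rewrite ltW.
exact: ((UC_leP _ _).1 (fe (MkI01 h) e0) x).
Qed.
Next Obligation.
move=> X Y f g fg; apply: met_map_ext => y.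
have [x] := ms_inhabited X.
exact: (congr1 (fun h : UC (met_prod X Y) => (h : met_map _ _) (x, y)) fg).
Qed.
Next Obligation.
move=> X Y g h; split=> /UC_leP gh; apply/UC_leP.
  by move=> [x y]; apply: le_trans (gh y); exact: (val_sup01_ub (fun x : X => g (x, y)) x).
move=> y; apply: val_sup01_le; first exact: I01_ge0.
by move=> x; exact: (gh (x, y)).
Qed.
Next Obligation.
move=> X Y r; apply: met_map_ext => y; apply: val_inj; apply: le_anti.
have [x] := ms_inhabited X; apply/andP; split.
  by apply: val_sup01_le => //; exact: I01_ge0.
exact: (val_sup01_ub (fun _ : X => r) x).
Qed.
Next Obligation.
move=> X Y g h /UC_leP gh; apply/UC_leP => y.
apply: val_sup01_le => [|x].
  exact: I01_ge0.
by apply: le_trans (gh (x, y)) _; exact: (val_sup01_ub (fun x : X => h (x, y)) x).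
Qed.

Lemma Met_exE (X Y : met_space) (g : UC (met_prod X Y)) y :
  (exe (g : LL (prd (X : Met_sc) (Y : Met_sc))) : UC Y) y =
  inf01 (fun x : X => g (x, y)).
Proof.
pose G : UC (met_prod X Y) :=
  cla_op2 (conn_dotminus R) (cla_const (I01_1 R)) g.
have GE x : (G (x, y) : R) = 1 - (g (x, y) : R).
  by rewrite /G UC_op2E conn2E /= max_l// subr_ge0; exact: I01_le1.
pose S := sup01 (fun x : X => G (x, y)).
have -> : (exe (g : LL (prd (X : Met_sc) (Y : Met_sc))) : UC Y) y =
    conn_apply (conn_dotminus R) (pair2 (I01_1 R) S) by exact: UC_op2E.
rewrite conn2E; apply: val_inj; rewrite /= max_l ?subr_ge0; last exact: (I01_le1 S).
apply: le_anti; apply/andP; split.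
  apply: val_inf01_ge; first by rewrite gerBl; exact: (I01_ge0 S).
  move=> x; rewrite lerBlDl -lerBlDr -GE.
  exact: (val_sup01_ub (fun x : X => G (x, y)) x).
rewrite lerBrDl -lerBrDr; apply: val_sup01_le.
  by rewrite subr_ge0; exact: (I01_le1 (inf01 (fun x : X => g (x, y)))).
by move=> x; rewrite GE lerD2l lerN2; exact: (val_inf01_lb (fun x : X => g (x, y)) x).
Qed.

Section Pointwise.
Variables (L : language) (M : structure Met_sc L).

Definition met_car (s : lsort L) : Type := (str_ob M s : met_space).

Fixpoint env_point (G : ctx (lsort L)) :
    env met_car G -> (ctx_ob (str_ob M) G : met_space) :=
  match G return env met_car G -> (ctx_ob (str_ob M) G : met_space) with
  | cnil => fun _ => tt : met_point
  | cone s => fun a => a tt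
  | ccat G1 G2 => fun a =>
      (env_point (fun q => a (inl q)), env_point (fun q => a (inr q)))
  end.

Definition point_env (G : ctx (lsort L)) (x : (ctx_ob (str_ob M) G : met_space)) :
    env met_car G :=
  fun p => (ctx_proj (str_ob M) p : met_map _ _) x.

Lemma env_pointK G (a : env met_car G) : point_env (env_point a) = a.
Proof.
elim: G a => [|s|G1 IH1 G2 IH2] a; apply: functional_extensionality_dep => p.
- by case: p.
- by case: p.
case: p => q.
- exact: (congr1 (fun e : env met_car G1 => e q) (IH1 (fun q => a (inl q)))).
- exact: (congr1 (fun e : env met_car G2 => e q) (IH2 (fun q => a (inr q)))).
Qed.

Lemma point_envK G (x : (ctx_ob (str_ob M) G : met_space)) :
  env_point (point_env x) = x.
Proof.
elim: G x => [|s|G1 IH1 G2 IH2] //=; first by case.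
by case=> x1 x2; rewrite -[in RHS](IH1 x1) -[in RHS](IH2 x2).
Qed.

Definition met_structure01 : structure01 R L :=
  {| s01_car := met_car;
     s01_fun := fun f (a : env met_car (lfun_dom f)) =>
       (str_fun M f : met_map _ _) (env_point a);
     s01_rel := fun r (a : env met_car (lrel_dom r)) =>
       (str_rel M r : met_map _ _) (env_point a) |}.

Lemma ctx_tuple_point (X : met_space) G
    (h : forall p : pos G, met_map X (str_ob M (sort_at p) : met_space)) x :
  (ctx_tuple (h : forall p : pos G, @hom Met_sc X (str_ob M (sort_at p)))
    : met_map _ _) x = env_point (fun p => h p x).
Proof.
elim: G h => [|s|G1 IH1 G2 IH2] h //=.
by congr pair; [exact: IH1 | exact: IH2].
Qed.

Lemma met_term01 G s (t : term G s) x :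
  term01 t (point_env x : env (s01_car met_structure01) G) =
  (term_mor M t : met_map _ _) x.
Proof.
elim: t => //= f ts IH; congr (mm_fun _ _).
rewrite (ctx_tuple_point (fun q => term_mor M (ts q))); congr env_point.
by apply: functional_extensionality_dep => q; exact: IH.
Qed.

Lemma sup01_range (T U : Type) (f : T -> I01) (g : U -> I01) :
  (forall t, exists u, f t = g u) -> (forall u, exists t, f t = g u) ->
  sup01 f = sup01 g.
Proof.
move=> fg gf; apply: val_inj; congr (sup (_ `|` _)); apply/seteqP.
split=> r [t ->]; first by have [u ->] := fg t; exists u.
by have [u <-] := gf t; exists u.
Qed.

Lemma inf01_range (T U : Type) (f : T -> I01) (g : U -> I01) :
  (forall t, exists u, f t = g u) -> (forall u, exists t, f t = g u) ->
  inf01 f = inf01 g.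
Proof.
move=> fg gf; apply: val_inj; congr (inf (_ `|` _)); apply/seteqP.
split=> r [t ->]; first by have [u ->] := fg t; exists u.
by have [u <-] := gf t; exists u.
Qed.

Lemma point_env_cat D G (x : (ctx_ob (str_ob M) D : met_space))
    (y : (ctx_ob (str_ob M) G : met_space)) :
  env_cat (point_env x) (point_env y) =
  point_env ((x, y) : (ctx_ob (str_ob M) (ccat D G) : met_space)).
Proof. by apply: functional_extensionality_dep => -[q|q]. Qed.

Lemma met_value01 G (phi : formula R G) (x : (ctx_ob (str_ob M) G : met_space)) :
  value01 (M := met_structure01) phi (point_env x) =
  (interp M phi : met_map _ _) x.
Proof.
elim: phi x => {G} [G r ts|G n u phis IH|D G psi IH|D G psi IH] x /=.
- congr (mm_fun _ _); rewrite (ctx_tuple_point (fun q => term_mor M (ts q))).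
  congr env_point; apply: functional_extensionality_dep => q; exact: met_term01.
- by congr conn_apply; apply/funext => i; exact: IH.
- apply: sup01_range => [a|y].
    by exists (env_point a); rewrite -IH -point_env_cat env_pointK.
  by exists (point_env y); rewrite point_env_cat IH.
- apply: etrans (esym (Met_exE (interp M psi) x)).
  apply: inf01_range => [a|y].
    by exists (env_point a); rewrite -IH -point_env_cat env_pointK.
  by exists (point_env y); rewrite point_env_cat IH.
Qed.

Lemma met_modelsP G (phi : formula R G) :
  models M phi <-> forall x, (interp M phi : met_map _ _) x = I01_0 R.
Proof.
split=> [-> //|H]; exact: met_map_ext.
Qed.

Lemma met_models01 G (phi : formula R G) :
  models M phi <-> models01 met_structure01 phi.
Proof.
rewrite met_modelsP; split=> H x; last by rewrite -met_value01.
by rewrite -(env_pointK x) met_value01.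
Qed.

End Pointwise.

Program Definition met_dist (X : met_space) : UC (met_prod X X) :=
  {| mm_fun := fun p => @MkI01 R (mdist p.1 p.2) _ |}.
Next Obligation. by move=> X p; rewrite mdist_ge0 ms_bounded. Qed.
Next Obligation.
move=> X; apply/unif_mdistP => e e0; exists (e / 2); first by rewrite divr_gt0.
move=> [x y] [x' y']; rewrite mdist_prodE gt_max /= => /andP[xx' yy'].
rewrite mdistI01E /= ltr_norml ltrNl opprB !ltrBlDr.
have T (a b c d : X) : mdist a c < e / 2 -> mdist b d < e / 2 ->
    mdist a b < e + mdist c d.
  move=> ac bd; apply: le_lt_trans (metric_triangle _ c _) _.
  rewrite [X in _ < X + _]splitr -addrA ltr_leD//.
  apply: le_trans (metric_triangle _ d _) _.
  by rewrite [leRHS]addrC lerD2l metric_sym ltW.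
by rewrite !T// metric_sym.
Qed.

Lemma Met_theory_closure (G : ctx Met_sc)
    (phi : formula R (ccat G cnil : ctx (lsort (canonical_language Met_sc)))) :
  (forall x, (interp (canonical_structure Met_sc) phi : met_map _ _) x = I01_0 R) ->
  forall N : structure01 R (canonical_language Met_sc),
    models01_theory N (canonical_theory (C := Met_sc)) ->
  forall (a : env (s01_car N) G) (b : env (s01_car N) cnil),
    value01 (M := N) phi (env_cat a b) = I01_0 R.
Proof.
move=> H N NT a b.
have : models (canonical_structure Met_sc) (fall phi).
  apply/met_modelsP => x /=; apply: val_inj; apply: le_anti; apply/andP; split.
    by apply: val_sup01_le => // y; rewrite H.
  exact: I01_ge0.
move=> /NT /(_ b) E; apply: val_inj; apply: le_anti.
rewrite I01_ge0 andbT -E.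
exact: (val_sup01_ub (fun a => value01 (M := N) phi (env_cat a b)) a).
Qed.

Local Notation canT := (canonical_theory (C := Met_sc)).
Local Notation canM := (canonical_structure Met_sc).
Local Notation canL := (canonical_language Met_sc).

Lemma value01_fconn2 (L : language) (N : structure01 R L) (G : ctx (lsort L))
    u (phi psi : formula R G) a :
  value01 (M := N) (fconn2 u phi psi) a =
  conn_apply u (pair2 (value01 (M := N) phi a) (value01 (M := N) psi a)).
Proof.
rewrite /= -(pair2_comp (fun phi => value01 (M := N) phi a)); congr conn_apply.
Qed.

(* phi' and psi' are phi and psi over a context extended by the empty tuple *)
Lemma Met_entails (G : ctx (lsort canL)) (phi psi : formula R G)
    (phi' psi' : formula R (ccat G cnil)) (d e : I01) :
  (forall (N : structure01 R canL) (a : env (s01_car N) G)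
     (b : env (s01_car N) cnil),
     value01 (M := N) phi' (env_cat a b) = value01 (M := N) phi a) ->
  (forall (N : structure01 R canL) (a : env (s01_car N) G)
     (b : env (s01_car N) cnil),
     value01 (M := N) psi' (env_cat a b) = value01 (M := N) psi a) ->
  (forall x, ((interp canM phi : met_map _ _) x : R) < (d : R) ->
     ((interp canM psi : met_map _ _) x : R) <= (e : R)) ->
  entails_lt_le canT phi d psi e.
Proof.
move=> phiE psiE H N NT a.
pose fc r : formula R (ccat G cnil) := fconn (conn_const r) (@empty_fun _).
pose chi := fconn2 (conn_min R) (fconn2 (conn_dotminus R) (fc d) phi')
                                (fconn2 (conn_dotminus R) psi' (fc e)).
have chiE (K : structure01 R canL) (c : env (s01_car K) G) (b : env (s01_car K) cnil) :
    (value01 (M := K) chi (env_cat c b) : R) =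
    Num.min (Num.max ((d : R) - (value01 (M := K) phi c : R)) 0)
            (Num.max ((value01 (M := K) psi c : R) - (e : R)) 0).
  by rewrite !value01_fconn2 !conn2E phiE psiE.
have chi0 : forall x, (interp canM chi : met_map _ _) x = I01_0 R.
  move=> [x b]; rewrite -met_value01 -point_env_cat; apply: val_inj.
  rewrite [LHS]chiE !met_value01 /=.
  have [lt|ge] := ltP ((interp canM phi : met_map _ _) x : R) (d : R).
    by rewrite (max_r (_ : _ - I01val e <= 0)) ?subr_le0 ?H// min_r// le_max lexx orbT.
  by rewrite (max_r (_ : I01val d - _ <= 0)) ?subr_le0// min_l// le_max lexx orbT.
have := Met_theory_closure chi0 NT a (fun p => match p with end).
move=> /(congr1 (@I01val R)); rewrite chiE => E lt.
rewrite leNgt; apply/negP => gt.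
move: E; apply/eqP; rewrite gt_eqF// lt_min !lt_max !subr_gt0 lt gt //.
Qed.

Lemma Met_entails_real (G : ctx (lsort canL)) (phi psi : formula R G)
    (phi' psi' : formula R (ccat G cnil)) :
  (forall (N : structure01 R canL) (a : env (s01_car N) G)
     (b : env (s01_car N) cnil),
     value01 (M := N) phi' (env_cat a b) = value01 (M := N) phi a) ->
  (forall (N : structure01 R canL) (a : env (s01_car N) G)
     (b : env (s01_car N) cnil),
     value01 (M := N) psi' (env_cat a b) = value01 (M := N) psi a) ->
  (forall e : R, 0 < e -> exists2 d : R, 0 < d &
     forall x, ((interp canM phi : met_map _ _) x : R) < d ->
       ((interp canM psi : met_map _ _) x : R) <= e) ->
  forall e : R, 0 < e -> exists2 d : R, 0 < d & entails_lt_le canT phi d psi e.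
Proof.
move=> phiE psiE H e e0.
have [e1|/ltW e1] := leP e 1; last first.
  by exists 1 => // N NT a _; apply: le_trans e1; exact: I01_le1.
have [d d0 D] := H e e0.
have he : 0 <= e <= 1 by rewrite ltW.
have hd : 0 <= Num.min d 1 <= 1 by rewrite le_min ler01 ltW//= ge_min lexx orbT.
exists (Num.min d 1); first by rewrite lt_min d0 ltr01.
apply: (@Met_entails G phi psi phi' psi' (MkI01 hd) (MkI01 he)) => // x /=.
by rewrite lt_min => /andP[/D].
Qed.

Lemma rel_app2E (N : structure01 R canL) (X : Met_sc) (d : LL (prd X X))
    (G : ctx Met_sc) (t s : @term canL G X) a :
  value01 (M := N) (rel_app2 d t s) a =
  s01_rel (s := N) (r := @CanonicalRel R Met_sc (ccat (cone X) (cone X)) d)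
    (fun q => match q with inl _ => term01 t a | inr _ => term01 s a end).
Proof.
rewrite /=; congr s01_rel; apply: functional_extensionality_dep => -[q|q] //.
Qed.

Program Definition Met : metric_logical_category R :=
  {| mlc_cat := Met_sc; mlc_dist := met_dist |}.
Next Obligation.
move=> X; split; apply/met_modelsP.
- by move=> x; apply: val_inj; rewrite /= mdistxx.
- move=> [x y]; rewrite -met_value01 value01_fconn2 conn2E !met_value01.
  by apply: val_inj; rewrite /= (metric_sym y x) subrr maxxx.
- move=> [x [y z]]; rewrite -met_value01 !value01_fconn2 !conn2E !met_value01.
  apply: val_inj; rewrite /= max_r// subr_le0 le_min metric_triangle.
  exact: ms_bounded.
Qed.
Next Obligation.
move=> X Y f.
pose x : @term canL (ccat (ctx2 X) cnil) X := @tvar canL (ccat (ctx2 X) cnil) (inl (inl tt)).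
pose y : @term canL (ccat (ctx2 X) cnil) X := @tvar canL (ccat (ctx2 X) cnil) (inl (inr tt)).
refine (@Met_entails_real _ _ _ (@rel_app2 R Met_sc X (met_dist X) _ x y)
  (@rel_app2 R Met_sc Y (met_dist Y) _ (fun_app f x) (fun_app f y)) _ _ _).
- by move=> N a b; rewrite !rel_app2E.
- by move=> N a b; rewrite !rel_app2E.
- move=> e e0; have [d d0 D] := (unif_mdistP (f : met_map _ _)).1 (mm_unif f) e e0.
  by exists d => // -[u v] /D /ltW.
Qed.
Next Obligation.
move=> Y g.
pose x : @term canL (ccat (ctx2 Y) cnil) Y := @tvar canL (ccat (ctx2 Y) cnil) (inl (inl tt)).
pose y : @term canL (ccat (ctx2 Y) cnil) Y := @tvar canL (ccat (ctx2 Y) cnil) (inl (inr tt)).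
refine (@Met_entails_real _ _ _ (@rel_app2 R Met_sc Y (met_dist Y) _ x y)
  (fconn2 (conn_absdiff R) (rel_app g x) (rel_app g y)) _ _ _).
- by move=> N a b; rewrite !rel_app2E.
- by move=> N a b; rewrite !value01_fconn2.
- move=> e e0; have [d d0 D] := (unif_mdistP (g : met_map _ _)).1 (mm_unif g) e e0.
  exists d => // -[u v] /D; rewrite mdistI01E => guv.
  rewrite -met_value01 value01_fconn2 conn2E !met_value01 /= ge_max.
  apply/andP; split; apply: le_trans (ltW guv); first exact: ler_norm.
  by rewrite distrC; exact: ler_norm.
Qed.
Next Obligation.
move=> X Y f g H; apply: met_map_ext => x.
have := H (met_structure01 canM) (fun phi => (met_models01 canM phi).1).
move/met_models01/met_modelsP => /(_ x) /(congr1 (@I01val R)) /=.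
exact: mdist_positivity.
Qed.

End MetricSpaces.

Section Models.
Variables (R : realType) (C D : metric_logical_category R).

Record model := Model {
  md_str :> structure D (canonical_language C);
  md_models : models_theory md_str (canonical_theory (C := C));
  md_dist : forall a : C,
    str_rel md_str
      (@CanonicalRel R C (ccat (cone a) (cone a)) (mlc_dist a)) =
    mlc_dist (str_ob md_str a) }.

Record elementary_map (M N : model) := ElementaryMap {
  em_map :> forall a : lsort (canonical_language C),
    hom (str_ob M a) (str_ob N a);
  em_elementary : forall (G : ctx (lsort (canonical_language C)))
      (phi : formula R G),
    interp M phi = pull (ctx_map em_map G) (interp N phi) }.

Lemma elementary_map_ext (M N : model) (h k : elementary_map M N) :
  (forall a, h a = k a) -> h = k.
Proof.
case: h k => [h hh] [k hk] /= e.
have {}e : h = k by apply: functional_extensionality_dep.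
by rewrite {}e in hh *; congr ElementaryMap; exact: Prop_irrelevance.
Qed.

Program Definition elementary_id (M : model) : elementary_map M M :=
  {| em_map := fun a => idm (str_ob M a) |}.
Next Obligation. by move=> M G phi; rewrite ctx_map_id pull_id. Qed.

Program Definition elementary_comp (M N P : model) (k : elementary_map N P)
    (h : elementary_map M N) : elementary_map M P :=
  {| em_map := fun a => comp (k a) (h a) |}.
Next Obligation.
by move=> M N P k h G phi; rewrite ctx_map_comp pull_comp -!em_elementary.
Qed.

Program Definition Mod_star : category :=
  {| ob := model; hom := elementary_map;
     idm := elementary_id; comp := elementary_comp |}.
Next Obligation.
by move=> M N h; apply: elementary_map_ext => a; exact: comp_idl.
Qed.
Next Obligation.
by move=> M N h; apply: elementary_map_ext => a; exact: comp_idr.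
Qed.
Next Obligation.
by move=> M N P Q h g f; apply: elementary_map_ext => a; exact: compA.
Qed.

End Models.

Section LogicalFunctors.
Variables (R : realType) (C D : metric_logical_category R).

Definition comparison (I : functor C D) (a b : C) :
    hom (I (prd a b)) (prd (I a) (I b)) :=
  pairm (fmap I (pr1 a b)) (fmap I (pr2 a b)).

(* [lf_all] says that lf_nat commutes with the quantifiers: by [lf_prd], k is
   the image of g transported along the isomorphism I (a x b) = I a x I b.
   A natural family of homomorphisms need not do so (e.g. restrict the
   predicates of a structure to a substructure that is not elementary), and
   then it does not define a model.
   Homomorphisms lf_nat are not required to be injective: at the terminal
   object this would force L(1) to embed in [0,1] when the target is Met, so
   that an incomplete canonical theory, which has models, would have no
   logical functor.  See [logical_embedding] and [complete_mlc]. *)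
Record logical_functor := LogicalFunctor {
  lf_fun :> functor C D;
  lf_one : is_iso (bang (lf_fun (one C)));
  lf_prd : forall a b : C, is_iso (comparison lf_fun a b);
  lf_nat : nat_trans (sc_L C) (functor_comp (sc_L D) (functor_opp lf_fun));
  lf_all : forall (a b : C) (g : LL (prd a b))
      (k : LL (prd (lf_fun a) (lf_fun b))),
    pull (comparison lf_fun a b) k = (lf_nat (prd a b) : cla_hom _ _) g ->
    alle k = (lf_nat b : cla_hom _ _) (alle g);
  lf_dist : forall a : C,
    pull (comparison lf_fun a a) (mlc_dist (lf_fun a)) =
    (lf_nat (prd a a) : cla_hom _ _) (mlc_dist a) }.

Definition logical_embedding (F : logical_functor) : Prop :=
  forall a : C, injective (lf_nat F a : cla_hom _ _).

(* The component of lt_eps is the action of L on that of lt_eta: an lt_eps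
   unrelated to lt_eta would leave lt_eta unconstrained by the predicates. *)
Record logical_trans (F G : logical_functor) := LogicalTrans {
  lt_eta : nat_trans F G;
  lt_eps : nat_trans (functor_comp (sc_L D) (functor_opp G))
                     (functor_comp (sc_L D) (functor_opp F));
  lt_triangle : forall a : C, lf_nat F a = comp (lt_eps a) (lf_nat G a);
  lt_eps_eta : forall a : C, lt_eps a = pull (lt_eta a) }.

Lemma logical_trans_ext (F G : logical_functor) (s t : logical_trans F G) :
  (forall a, lt_eta s a = lt_eta t a) -> s = t.
Proof.
case: s t => [s s' hs es] [t t' ht et] /= st.
have e : s = t by exact: nat_trans_ext.
have e' : s' = t' by apply: nat_trans_ext => a; rewrite es et st.
by rewrite {}e {}e' in hs es *; congr LogicalTrans; exact: Prop_irrelevance.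
Qed.

Program Definition logical_trans_id (F : logical_functor) : logical_trans F F :=
  {| lt_eta := nat_id F;
     lt_eps := nat_id (functor_comp (sc_L D) (functor_opp F)) |}.
Next Obligation. by move=> F a; rewrite comp_idl. Qed.
Next Obligation.
by move=> F a; apply: cla_hom_ext => x; rewrite /= pull_id.
Qed.

Program Definition logical_trans_comp (F G H : logical_functor)
    (t : logical_trans G H) (s : logical_trans F G) : logical_trans F H :=
  {| lt_eta := nat_comp (lt_eta t) (lt_eta s);
     lt_eps := nat_comp (lt_eps s) (lt_eps t) |}.
Next Obligation.
by move=> F G H t s a; rewrite (lt_triangle s) (lt_triangle t) compA.
Qed.
Next Obligation.
move=> F G H t s a; apply: cla_hom_ext => x.
by rewrite /= pull_comp (lt_eps_eta s) (lt_eps_eta t).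
Qed.

Program Definition Hom_star : category :=
  {| ob := logical_functor; hom := logical_trans;
     idm := logical_trans_id; comp := logical_trans_comp |}.
Next Obligation.
by move=> F G s; apply: logical_trans_ext => a; exact: comp_idl.
Qed.
Next Obligation.
by move=> F G s; apply: logical_trans_ext => a; exact: comp_idr.
Qed.
Next Obligation.
by move=> F G H K u t s; apply: logical_trans_ext => a; exact: compA.
Qed.

Definition Hom_star_embedding : category :=
  full_subcategory (C := Hom_star) logical_embedding.

End LogicalFunctors.

(* Every sentence has a definite value, i.e. the canonical theory is complete *)
Definition complete_mlc (R : realType) (C : metric_logical_category R) : Prop :=
  forall a : LL (one C), exists r : I01 R, a = cla_const r.

(* Main.v *)
From mathcomp Require Import all_boot all_order all_algebra.
From mathcomp Require Import lra.
From mathcomp Require Import boolp reals.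
Require Import Defs.
Import Order.TTheory GRing.Theory Num.Theory.

Set Implicit Arguments.
Unset Strict Implicit.
Unset Printing Implicit Defensive.

Local Open Scope ring_scope.

(** A model of the canonical theory and a logical functor are the same data seen
    twice.  A model M in D names an object of D for every sort, that is for
    every object of C, a morphism for every function symbol, that is for every
    morphism of C, and an element of L for every relation symbol.  Conversely a
    logical functor F yields a structure: transport the value of F on morphisms
    and elements along the isomorphism between F (A_1 x ... x A_n) and
    F A_1 x ... x F A_n ([comparison_ctx]).  The argument works for any metric
    logical category D as target, and the equivalence is proved at that
    generality ([models_functors_equivalent]).

    From models to functors, functoriality, preservation of products and
    naturality are equations between terms or formulas that hold in C.  Those
    between formulas pass to a model because the closure of phi -. psi is a
    sentence of the canonical theory ([model_eq]); those between terms because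
    the closure of d (t, s) is such a sentence, because the model interprets d
    by the distance of D, and because distance 0 forces equality of morphisms
    of D ([model_term], [dist_separated]).  Likewise an elementary map h
    preserves the formula d (f x, y), which makes it a natural transformation
    ([elementary_natural]).

    From functors to models, an induction on formulas shows that the element
    part of F carries the value of a formula in C to its value in the structure
    built from F ([interp_functor]); hence that structure is a model and
    logical transformations are elementary.  Quantifiers are the one delicate
    case: an isomorphism of the context has to commute with them, which follows
    from their adjunction ([alle_pull_iso]).

    Both round trips give back the same objects of D, and identity morphisms are
    the components of the natural isomorphisms.  Going from models to models,
    this uses that a symbol with domain A_1, ..., A_n agrees with the unary
    symbol of the same datum on the product ([round_trip_fun],
    [round_trip_rel]).

    Finally, when every sentence has a definite value, every logical functor to
    metric spaces is an embedding ([complete_embedding]): that x <= y is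
    expressed by a sentence whose value is a constant, and constants of L(1) can
    be told apart in a nonempty space.  The embeddings are then all the logical
    functors, so the second equivalence is the first. *)

(** * Isomorphisms and their inverses *)

Lemma is_iso_id (C : category) (a : C) : is_iso (idm a).
Proof. by exists (idm a); rewrite !comp_idl. Qed.

Lemma is_iso_comp (C : category) (a b c : C) (g : hom b c) (f : hom a b) :
  is_iso g -> is_iso f -> is_iso (comp g f).
Proof.
move=> [g' [g'g gg']] [f' [f'f ff']]; exists (comp f' g'); split.
  by rewrite -compA (compA g') g'g comp_idl.
by rewrite -compA (compA f) ff' comp_idl.
Qed.

Definition iso_inv (C : category) (a b : C) (f : hom a b) (fi : is_iso f) :
  hom b a := sval (cid fi).

Lemma iso_invK (C : category) (a b : C) (f : hom a b) (fi : is_iso f) :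
  comp (iso_inv fi) f = idm a.
Proof. exact: (svalP (cid fi)).1. Qed.

Lemma iso_invKV (C : category) (a b : C) (f : hom a b) (fi : is_iso f) :
  comp f (iso_inv fi) = idm b.
Proof. exact: (svalP (cid fi)).2. Qed.

(** * The order of a continuous logical algebra *)

Section Order.
Variables (R : realType) (X : cla R).
Implicit Types a b c : X.

Let v2 (Y : Type) (a b : Y) (k : nat) : Y := if k is 0%N then a else b.
Let tc (r : I01 R) : cla_term R := cla_app (conn_const r) (@empty_fun _).
Let t2 (u : connective R 2) (s t : cla_term R) : cla_term R :=
  cla_app u (pair2 s t).

Let eval_tc (v : nat -> X) r : cla_eval (@cla_op R X) v (tc r) = cla_const r.
Proof. by congr cla_op; exact: empty_funE. Qed.

Let eval_t2 (Y : Type) (op : forall n, connective R n -> ('I_n -> Y) -> Y)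
    (v : nat -> Y) u s t :
  cla_eval op v (t2 u s t) = op 2%N u (pair2 (cla_eval op v s) (cla_eval op v t)).
Proof. by rewrite -(pair2_comp (cla_eval op v)). Qed.

Let x0 : cla_term R := cla_var R 0.
Let x1 : cla_term R := cla_var R 1.

Ltac identity :=
  let w := fresh in
  intro w; rewrite ?eval_t2 ?conn2E /=; apply: val_inj => /=;
  move: (I01P (w 0%N)) (I01P (w 1%N)) => /andP[? ?] /andP[? ?];
  rewrite /Num.min /Num.max;
  (* comparisons are split innermost first, so that no test mentions another *)
  repeat match goal with |- context [Order.lt ?x ?y] =>
    lazymatch x with context [Order.lt] => fail | _ => case: (ltP x y) => ? end
  end; lra.

Lemma cla_minC a b : cla_op2 (conn_min R) a b = cla_op2 (conn_min R) b a.
Proof.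
have /(@cla_identities R X)/(_ (v2 a b)) :
  cla_identity (t2 (conn_min R) x0 x1) (t2 (conn_min R) x1 x0) by identity.
by rewrite !eval_t2.
Qed.

(** The two identities min (a, b) = a -. (a -. b) and min (a, b) -. b = 0 make
    a <= b equivalent to the equation a -. b = 0, so that inequalities between
    formulas become sentences. *)
Lemma cla_dotminus_min a b :
  cla_op2 (conn_min R) a b =
  cla_op2 (conn_dotminus R) a (cla_op2 (conn_dotminus R) a b).
Proof.
have /(@cla_identities R X)/(_ (v2 a b)) : cla_identity (t2 (conn_min R) x0 x1)
  (t2 (conn_dotminus R) x0 (t2 (conn_dotminus R) x0 x1)) by identity.
by rewrite !eval_t2.
Qed.

Lemma cla_min_dotminus a b :
  cla_op2 (conn_dotminus R) (cla_op2 (conn_min R) a b) b = cla_const (I01_0 R).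
Proof.
have /(@cla_identities R X)/(_ (v2 a b)) : cla_identity
  (t2 (conn_dotminus R) (t2 (conn_min R) x0 x1) x1) (tc (I01_0 R)) by identity.
by rewrite !eval_t2 eval_tc.
Qed.

Lemma cla_dotminus0 a : cla_op2 (conn_dotminus R) a (cla_const (I01_0 R)) = a.
Proof.
have /(@cla_identities R X)/(_ (v2 a a)) : cla_identity
  (t2 (conn_dotminus R) x0 (tc (I01_0 R))) x0 by identity.
by rewrite !eval_t2 eval_tc.
Qed.

Lemma cla_min0 a :
  cla_op2 (conn_min R) a (cla_const (I01_0 R)) = cla_const (I01_0 R).
Proof.
have /(@cla_identities R X)/(_ (v2 a a)) : cla_identity
  (t2 (conn_min R) x0 (tc (I01_0 R))) (tc (I01_0 R)) by identity.
by rewrite !eval_t2 eval_tc.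
Qed.

Lemma cla_lexx a : cla_le a a.
Proof.
have /(@cla_identities R X)/(_ (v2 a a)) :
  cla_identity x0 (t2 (conn_min R) x0 x0) by identity.
by rewrite !eval_t2.
Qed.

Lemma cla_le_anti a b : cla_le a b -> cla_le b a -> a = b.
Proof. by move=> ab ba; rewrite ab cla_minC; exact: esym. Qed.

Lemma cla_le0 a : cla_le a (cla_const (I01_0 R)) -> a = cla_const (I01_0 R).
Proof. by move=> a0; rewrite a0 cla_min0. Qed.

Lemma cla_leP a b :
  cla_le a b <-> cla_op2 (conn_dotminus R) a b = cla_const (I01_0 R).
Proof.
split=> [->|ab]; first exact: cla_min_dotminus.
by rewrite /cla_le cla_dotminus_min ab cla_dotminus0.
Qed.

End Order.

Lemma cla_hom_le (R : realType) (X Y : cla R) (f : cla_hom X Y) a b :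
  cla_le a b -> cla_le (f a) (f b).
Proof. by move=> ab; rewrite /cla_le -cla_hom_op2 -ab. Qed.

(** * Products, and quantifiers along isomorphisms *)

Section Syntactic.
Variables (R : realType) (C : syntactic_category R).

Lemma pair_ext (x a b : C) (h k : hom x (prd a b)) :
  comp (pr1 a b) h = comp (pr1 a b) k -> comp (pr2 a b) h = comp (pr2 a b) k ->
  h = k.
Proof. by move=> h1 h2; rewrite (pairmE h) (pairmE k) h1 h2. Qed.

Lemma pairm_comp (x y a b : C) (f : hom x a) (g : hom x b) (k : hom y x) :
  comp (pairm f g) k = pairm (comp f k) (comp g k).
Proof. by apply: pair_ext; rewrite compA ?pr1_pair ?pr2_pair. Qed.

Lemma prdm_pairm (x a b a' b' : C) (f : hom a a') (g : hom b b')
    (h : hom x a) (k : hom x b) :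
  comp (prdm f g) (pairm h k) = pairm (comp f h) (comp g k).
Proof. by rewrite pairm_comp -!compA pr1_pair pr2_pair. Qed.

Lemma pr1_prdm (a b a' b' : C) (f : hom a a') (g : hom b b') :
  comp (pr1 a' b') (prdm f g) = comp f (pr1 a b).
Proof. exact: pr1_pair. Qed.

Lemma pr2_prdm (a b a' b' : C) (f : hom a a') (g : hom b b') :
  comp (pr2 a' b') (prdm f g) = comp g (pr2 a b).
Proof. exact: pr2_pair. Qed.

Lemma is_iso_prdm (a b a' b' : C) (f : hom a a') (g : hom b b') :
  is_iso f -> is_iso g -> is_iso (prdm f g).
Proof.
move=> [f' [f'f ff']] [g' [g'g gg']]; exists (prdm f' g').
by rewrite -!prdm_comp f'f g'g ff' gg' !prdm_id.
Qed.

Lemma is_iso_pr1_one (a : C) : is_iso (pr1 a (one C)).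
Proof.
exists (pairm (idm a) (bang a)); split; last exact: pr1_pair.
apply: pair_ext; first by rewrite compA pr1_pair comp_idl comp_idr.
by rewrite [LHS]bangE [RHS]bangE.
Qed.

Lemma pull_iso_inj (a b : C) (f : hom a b) : is_iso f -> injective (pull f).
Proof.
move=> [g [_ fg]] x y xy.
by rewrite -(pull_id x) -(pull_id y) -fg !pull_comp xy.
Qed.

Lemma alleP (a b : C) (g : LL (prd a b)) (h : LL b) :
  cla_le (alle g) h <-> cla_le g (pull (pr2 a b) h).
Proof. exact: sc_all_adjoint. Qed.

(** Beck-Chevalley is not among the axioms of a syntactic category; along
    isomorphisms it follows from the adjunction. *)
Lemma alle_pull_iso (a b a' b' : C) (f : hom a' a) (g : hom b' b)
    (x : LL (prd a b)) :
  is_iso f -> is_iso g -> alle (pull (prdm f g) x) = pull g (alle x).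
Proof.
move=> [f' [f'f ff']] [g' [g'g gg']]; apply: cla_le_anti.
  apply/alleP; rewrite -pull_comp -(pr2_prdm f g) pull_comp; apply: cla_hom_le.
  by apply/alleP; exact: cla_lexx.
rewrite -[alle (pull _ _)]pull_id -g'g pull_comp; apply: cla_hom_le.
apply/alleP; rewrite -pull_comp -(pr2_prdm f' g') pull_comp.
rewrite -[x in cla_le x _]pull_id -prdm_id -ff' -gg' prdm_comp pull_comp.
by apply: cla_hom_le; apply/alleP; exact: cla_lexx.
Qed.

Lemma exe_pull_iso (a b a' b' : C) (f : hom a' a) (g : hom b' b)
    (x : LL (prd a b)) :
  is_iso f -> is_iso g -> exe (pull (prdm f g) x) = pull g (exe x).
Proof.
move=> fi gi; rewrite /exe cla_hom_op2 cla_hom_const -(alle_pull_iso _ fi gi).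
by rewrite cla_hom_op2 cla_hom_const.
Qed.

Lemma alle_eq0 (a b : C) (x : LL (prd a b)) :
  alle x = cla_const (I01_0 R) <-> x = cla_const (I01_0 R).
Proof.
split=> [x0|->]; last exact: sc_all_const.
apply: cla_le0; rewrite -(cla_hom_const (pull (pr2 a b))) -x0.
by apply/alleP; exact: cla_lexx.
Qed.

(** * Tuples of morphisms into the object of a context *)

Section Tuples.
Variables (S : Type) (o : S -> C).

Lemma ctx_proj_tuple (x : C) (G : ctx S)
    (h : forall p : pos G, hom x (o (sort_at p))) p :
  comp (ctx_proj o p) (ctx_tuple h) = h p.
Proof.
elim: G h p => [|s|G1 IH1 G2 IH2] h p; first by case: p.
- by case: p; exact: comp_idl.
- case: p => p; rewrite -compA.
    by rewrite /= pr1_pair (IH1 (fun q => h (inl q))).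
  by rewrite /= pr2_pair (IH2 (fun q => h (inr q))).
Qed.

Lemma ctx_ext (x : C) (G : ctx S) (h k : hom x (ctx_ob o G)) :
  (forall p, comp (ctx_proj o p) h = comp (ctx_proj o p) k) -> h = k.
Proof.
elim: G h k => [|s|G1 IH1 G2 IH2] h k hk.
- by rewrite (bangE h) (bangE k).
- by have := hk tt; rewrite /= !comp_idl.
- apply: pair_ext.
    by apply: IH1 => p; rewrite !compA; exact: (hk (inl p)).
  by apply: IH2 => p; rewrite !compA; exact: (hk (inr p)).
Qed.

Lemma ctx_tuple_comp (x y : C) (G : ctx S)
    (h : forall p : pos G, hom x (o (sort_at p))) (k : hom y x) :
  comp (ctx_tuple h) k = ctx_tuple (fun p => comp (h p) k).
Proof. by apply: ctx_ext => p; rewrite compA !ctx_proj_tuple. Qed.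

Lemma ctx_proj_map (o' : S -> C) (h : forall s, hom (o s) (o' s)) (G : ctx S)
    (p : pos G) :
  comp (ctx_proj o' p) (ctx_map h G) = comp (h _) (ctx_proj o p).
Proof.
elim: G p => [|s|G1 IH1 G2 IH2] p; first by case: p.
- by rewrite /= comp_idl comp_idr.
- case: p => p /=.
    by rewrite -compA pr1_prdm !compA IH1.
  by rewrite -compA pr2_prdm !compA IH2.
Qed.

End Tuples.
End Syntactic.

(** * Substitution of terms for variables *)

Section Substitution.
Variable L : language.

Definition subst (G G' : ctx (lsort L)) : Type :=
  forall p : pos G, term G' (sort_at p).

Fixpoint tsubst (G G' : ctx (lsort L)) (sg : subst G G') s (t : term G s) :
    term G' s :=
  match t in term _ s return term G' s with
  | tvar p => sg p
  | tapp f ts => tapp (fun q => tsubst sg (ts q))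
  end.

Definition slift (D G G' : ctx (lsort L)) (sg : subst G G') :
    subst (ccat D G) (ccat D G') :=
  fun p => match p return term (ccat D G') (sort_at (p : pos (ccat D G))) with
    | inl q => @tvar L (ccat D G') (inl q)
    | inr q => tsubst (fun r => @tvar L (ccat D G') (inr r)) (sg q)
    end.
Arguments slift D {G G'} sg.

Fixpoint fsubst (R : realType) G (phi : formula R G) :
    forall G', subst G G' -> formula R G' :=
  match phi in formula _ G return forall G', subst G G' -> formula R G' with
  | frel _ r ts => fun G' sg => frel R (fun q => tsubst sg (ts q))
  | fconn _ n u phis => fun G' sg => fconn u (fun i => fsubst (phis i) sg)
  | fall D _ psi => fun G' sg => fall (fsubst psi (slift D sg))
  | fex D _ psi => fun G' sg => fex (fsubst psi (slift D sg))
  end.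

(** Adding a last, empty, tuple of variables: it turns a formula over G into
    one that a quantifier over G closes to a sentence. *)
Definition weaken (G : ctx (lsort L)) : subst G (ccat G cnil) :=
  fun p => @tvar L (ccat G cnil) (inl p).

Variables (R : realType) (C : syntactic_category R) (M : structure C L).

Definition subst_mor G G' (sg : subst G G') :
    hom (ctx_ob (str_ob M) G') (ctx_ob (str_ob M) G) :=
  ctx_tuple (fun p => term_mor M (sg p)).

Lemma term_mor_tsubst G G' (sg : subst G G') s (t : term G s) :
  term_mor M (tsubst sg t) = comp (term_mor M t) (subst_mor sg).
Proof.
elim: t => [p|f ts IH] /=; first by rewrite ctx_proj_tuple.
rewrite -compA ctx_tuple_comp; congr (comp _ (ctx_tuple _)).
by apply: functional_extensionality_dep => q; exact: IH.
Qed.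

Lemma subst_mor_slift D G G' (sg : subst G G') :
  subst_mor (slift D sg) = prdm (idm _) (subst_mor sg).
Proof.
apply: ctx_ext => -[p|p]; rewrite ctx_proj_tuple /= -compA.
  by rewrite pr1_prdm comp_idl.
rewrite pr2_prdm compA ctx_proj_tuple term_mor_tsubst; congr comp.
by apply: ctx_ext => q; rewrite ctx_proj_tuple.
Qed.

(** The hypothesis is what makes substitution commute with quantifiers, through
    Beck-Chevalley for isomorphisms. *)
Lemma interp_fsubst G (phi : formula R G) G' (sg : subst G G') :
  is_iso (subst_mor sg) ->
  interp M (fsubst phi sg) = pull (subst_mor sg) (interp M phi).
Proof.
elim: phi G' sg => {G} [G r ts|G n u phis IH|D G psi IH|D G psi IH] G' sg sgi /=.
- rewrite -pull_comp ctx_tuple_comp; congr (pull (ctx_tuple _) _).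
  by apply: functional_extensionality_dep => q; exact: term_mor_tsubst.
- by rewrite cla_hom_op; congr cla_op; apply/funext => i; exact: IH.
- have li : is_iso (subst_mor (slift D sg)).
    by rewrite subst_mor_slift; apply: is_iso_prdm => //; exact: is_iso_id.
  by rewrite IH// subst_mor_slift alle_pull_iso//; exact: is_iso_id.
- have li : is_iso (subst_mor (slift D sg)).
    by rewrite subst_mor_slift; apply: is_iso_prdm => //; exact: is_iso_id.
  by rewrite IH// subst_mor_slift exe_pull_iso//; exact: is_iso_id.
Qed.

Lemma subst_mor_weaken G : subst_mor (@weaken G) = pr1 _ (one C).
Proof. by apply: ctx_ext => p; rewrite ctx_proj_tuple. Qed.

Lemma interp_fconn2 G u (phi psi : formula R G) :
  interp M (fconn2 u phi psi) = cla_op2 u (interp M phi) (interp M psi).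
Proof. by rewrite /= (pair2_comp (interp M (G := G))). Qed.

(** Universal closure is how a formula with free variables is compared with a
    theory, which consists of sentences. *)
Lemma models_closure G (phi : formula R G) :
  models M (fall (fsubst phi (@weaken G))) <-> models M phi.
Proof.
have wi : is_iso (subst_mor (@weaken G)).
  by rewrite subst_mor_weaken; exact: is_iso_pr1_one.
rewrite /models /= (interp_fsubst phi wi) alle_eq0.
split=> [|->]; last exact: cla_hom_const.
by rewrite -(cla_hom_const (pull (subst_mor (@weaken G)))) => /(pull_iso_inj wi).
Qed.

End Substitution.

(** * Models of the canonical theory satisfy what holds in the category *)

Lemma value01_rel_app2 (R : realType) (C : syntactic_category R)
    (N : structure01 R (canonical_language C)) (b : C) (x : LL (prd b b))
    (G : ctx C) (t s : @term (canonical_language C) G b) e :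
  value01 (M := N) (rel_app2 x t s) e =
  s01_rel (s := N) (r := @CanonicalRel R C (ctx2 b) x)
    (fun q => match q with inl _ => term01 t e | inr _ => term01 s e end).
Proof.
by rewrite /=; congr s01_rel; apply: functional_extensionality_dep => -[].
Qed.

Lemma interp_rel_app2 (R : realType) (C : syntactic_category R)
    (D : syntactic_category R) (M : structure D (canonical_language C))
    (b : C) (x : LL (prd b b)) (G : ctx C)
    (t s : @term (canonical_language C) G b) :
  interp M (rel_app2 x t s) =
  pull (pairm (term_mor M t) (term_mor M s))
       (str_rel M (@CanonicalRel R C (ctx2 b) x)).
Proof. by []. Qed.

Lemma dist_diag (R : realType) (C : metric_logical_category R) (a b : C)
    (f : hom a b) : pull (pairm f f) (mlc_dist b) = cla_const (I01_0 R).
Proof.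
have [d0 _ _] := mlc_dist_pseudo_metric b.
have := congr1 (pull f) d0.
rewrite cla_hom_const interp_rel_app2 -pull_comp /= => <-; congr (pull _ _).
by apply: pair_ext; rewrite compA ?pr1_pair ?pr2_pair comp_idl.
Qed.

(** The separation axiom asks for an equation in all models of the canonical
    theory; its universal closure is a sentence of that theory. *)
Lemma dist_separated (R : realType) (C : metric_logical_category R) (a b : C)
    (f g : hom a b) :
  pull (pairm f g) (mlc_dist b) = cla_const (I01_0 R) -> f = g.
Proof.
move=> fg0; apply: mlc_hom_separated => N NT e.
have fg : models (canonical_structure C) (rel_app2 (mlc_dist b)
    (fun_app f (var1 a)) (fun_app g (var1 a))).
  by rewrite /models interp_rel_app2 /= !comp_idr.
pose nil_env : env (s01_car N) cnil := fun p => match p with end.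
have /NT/(_ nil_env) /(congr1 (@I01val R)) E :=
  (models_closure _ _).2 fg.
apply: val_inj; apply: le_anti; rewrite I01_ge0 andbT.
rewrite -[X in _ <= X]E.
set phi := fsubst _ _.
suff -> : value01 (M := N) (rel_app2 (mlc_dist b)
    (fun_app f (var1 a)) (fun_app g (var1 a))) e =
  value01 (M := N) phi (env_cat e nil_env).
  exact: (val_sup01_ub (fun e' => value01 (M := N) phi (env_cat e' nil_env)) e).
rewrite value01_rel_app2 /=; congr s01_rel.
by apply: functional_extensionality_dep => -[].
Qed.

Section Transfer.
Variables (R : realType) (C D : metric_logical_category R) (M : model C D).
Local Notation canL := (canonical_language C).
Local Notation canM := (canonical_structure C).

Lemma model_models (G : ctx (lsort canL)) (phi : formula R G) :
  models canM phi -> models M phi.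
Proof. by move=> /models_closure /md_models /models_closure. Qed.

(** An equation of formulas is two inequalities, each of which is the truth of
    a formula phi -. psi. *)
Lemma model_eq (G : ctx (lsort canL)) (phi psi : formula R G) :
  interp canM phi = interp canM psi -> interp M phi = interp M psi.
Proof.
move=> e; suff le (chi chi' : formula R G) :
    interp canM chi = interp canM chi' -> cla_le (interp M chi) (interp M chi').
  by apply: cla_le_anti; apply: le.
move=> {}e; apply/cla_leP; rewrite -interp_fconn2; apply: model_models.
by rewrite /models interp_fconn2; apply/cla_leP; rewrite e; exact: cla_lexx.
Qed.

(** An equation of terms is the truth of the formula d (t, s), since the model
    interprets d by the distance of D, which separates morphisms. *)
Lemma model_term (G : ctx (lsort canL)) (b : C) (t s : @term canL G b) :
  term_mor canM t = term_mor canM s -> term_mor M t = term_mor M s.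
Proof.
move=> ts; apply: dist_separated; rewrite -md_dist -interp_rel_app2.
apply: model_models; rewrite /models interp_rel_app2 ts.
exact: dist_diag.
Qed.

End Transfer.

(** * The logical functor of a model *)

Definition rel_app_pair (R : realType) (C : syntactic_category R) (a b : C)
    (x : LL (prd a b)) (G : ctx C) (t : @term (canonical_language C) G a)
    (s : @term (canonical_language C) G b) : @formula R (canonical_language C) G :=
  @frel R (canonical_language C) G (@CanonicalRel R C (ccat (cone a) (cone b)) x)
    (fun q => match q with inl _ => t | inr _ => s end).

(** The identity of a x b, taken as a function symbol with two arguments: in a
    model it is the inverse of the comparison morphism of a x b. *)
Definition pair_app (R : realType) (C : syntactic_category R) (a b : C)
    (G : ctx C) (t : @term (canonical_language C) G a)
    (s : @term (canonical_language C) G b) :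
    @term (canonical_language C) G (prd a b) :=
  @tapp (canonical_language C) G
    (@CanonicalFun R C (ccat (cone a) (cone b)) (prd a b) (idm (prd a b)))
    (fun q => match q with inl _ => t | inr _ => s end).

Lemma interp_rel_app1 (R : realType) (C : syntactic_category R)
    (D : syntactic_category R) (M : structure D (canonical_language C))
    (a : C) (x : LL a) :
  interp M (rel_app x (var1 a)) = str_rel M (@CanonicalRel R C (cone a) x).
Proof. exact: pull_id. Qed.

Section FunctorOfModel.
Variables (R : realType) (C D : metric_logical_category R) (M : model C D).
Local Notation canL := (canonical_language C).
Local Notation canM := (canonical_structure C).

Definition mor1 (a b : C) (f : hom a b) : hom (str_ob M a) (str_ob M b) :=
  str_fun M (@CanonicalFun R C (cone a) b f).

Definition elt1 (a : C) (x : LL a) : LL (str_ob M a) :=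
  str_rel M (@CanonicalRel R C (cone a) x).

Lemma mor1_id (a : C) : mor1 (idm a) = idm (str_ob M a).
Proof.
have := @model_term _ _ _ M _ _ (fun_app (idm a) (var1 a)) (var1 a) (comp_idl _).
by rewrite /= comp_idr.
Qed.

Lemma mor1_comp (a b c : C) (g : hom b c) (f : hom a b) :
  mor1 (comp g f) = comp (mor1 g) (mor1 f).
Proof.
have := @model_term _ _ _ M _ _ (fun_app (comp g f) (var1 a))
  (fun_app g (fun_app f (var1 a))) (esym (compA _ _ _)).
by rewrite /= !comp_idr.
Qed.

Definition model_fun : functor C D :=
  {| fob := (fun a : C => str_ob M a) : C -> D; fmap := mor1;
     fmap_id := mor1_id; fmap_comp := mor1_comp |}.

Lemma model_fun_one : is_iso (bang (model_fun (one C))).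
Proof.
pose f : canonical_fun C := @CanonicalFun R C cnil (one C) (idm (one C)).
exists (str_fun M f); split; last by rewrite [LHS]bangE [RHS]bangE.
pose t : @term canL (cone (one C)) (one C) :=
  @tapp canL _ f (fun p => match p with end).
by apply: (@model_term _ _ _ M _ _ t (var1 (one C))); rewrite [LHS]bangE [RHS]bangE.
Qed.

Lemma model_fun_prd (a b : C) : is_iso (comparison model_fun a b).
Proof.
pose G : ctx C := ccat (cone a) (cone b).
pose x : @term canL G a := @tvar canL G (inl tt).
pose y : @term canL G b := @tvar canL G (inr tt).
pose z := var1 (prd a b).
pose f : canonical_fun C := @CanonicalFun R C G (prd a b) (idm (prd a b)).
exists (str_fun M f); split.
  have := @model_term _ _ _ M _ _
    (pair_app (fun_app (pr1 a b) z) (fun_app (pr2 a b) z)) z.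
  rewrite /= !comp_idr; apply.
  by rewrite comp_idl; apply: pair_ext; rewrite ?pr1_pair ?pr2_pair comp_idr.
have tE (k : hom (prd (str_ob M a) (str_ob M b)) (str_ob M (prd a b))) :
    comp k (pairm (comp (idm _) (pr1 _ _)) (comp (idm _) (pr2 _ _))) = k.
  by rewrite -[pairm _ _]/(prdm _ _) prdm_id comp_idr.
apply: pair_ext; rewrite compA ?pr1_pair ?pr2_pair comp_idr.
  have : term_mor M (fun_app (pr1 a b) (pair_app x y)) = term_mor M x.
    by apply: model_term; rewrite /= comp_idl pr1_pair.
  by rewrite /= tE comp_idl.
have : term_mor M (fun_app (pr2 a b) (pair_app x y)) = term_mor M y.
  by apply: model_term; rewrite /= comp_idl pr2_pair.
by rewrite /= tE comp_idl.
Qed.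

Lemma elt1_op (a : C) n (u : connective R n) (x : 'I_n -> LL a) :
  elt1 (cla_op u x) = cla_op u (fun i => elt1 (x i)).
Proof.
have : interp M (rel_app (cla_op u x) (var1 a)) =
    interp M (fconn u (fun i => rel_app (x i) (var1 a))).
  apply: model_eq; rewrite interp_rel_app1.
  by congr cla_op; apply/funext => i; exact: (esym (pull_id _)).
rewrite interp_rel_app1 => h; apply: etrans h _.
by congr cla_op; apply/funext => i; exact: pull_id.
Qed.

Definition model_elt (a : C) : cla_hom (LL a) (LL (str_ob M a)) :=
  ClaHom (@elt1_op a).

Lemma elt1_pull (a b : C) (f : hom a b) (x : LL b) :
  elt1 (pull f x) = pull (mor1 f) (elt1 x).
Proof.
have : interp M (rel_app (pull f x) (var1 a)) =
    interp M (rel_app x (fun_app f (var1 a))).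
  by apply: model_eq; rewrite interp_rel_app1 /= comp_idr.
by rewrite interp_rel_app1 /= comp_idr.
Qed.

Lemma model_elt_natural (a b : opp_cat C) (f : hom a b) :
  comp (model_elt b : @hom (CLA R) _ _) (fmap (sc_L C) f) =
  comp (fmap (functor_comp (sc_L D) (functor_opp model_fun)) f)
    (model_elt a : @hom (CLA R) _ _).
Proof. by apply: cla_hom_ext => x; exact: elt1_pull. Qed.

Definition model_nat :
    nat_trans (sc_L C) (functor_comp (sc_L D) (functor_opp model_fun)) :=
  {| component := (fun a => model_elt a) :
       forall a : opp_cat C, @hom (CLA R) (sc_L C a)
         (functor_comp (sc_L D) (functor_opp model_fun) a);
     naturality := model_elt_natural |}.

(** An element of L(a x b) names a binary relation symbol as well as a unary
    one on the sort of a x b; a model interprets both alike. *)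
Lemma elt_pair (a b : C) (x : LL (prd a b)) :
  pull (comparison model_fun a b)
    (str_rel M (@CanonicalRel R C (ccat (cone a) (cone b)) x)) = elt1 x.
Proof.
pose z := var1 (prd a b).
have : interp M (rel_app_pair x (fun_app (pr1 a b) z) (fun_app (pr2 a b) z)) =
    interp M (rel_app x z).
  apply: model_eq; rewrite interp_rel_app1 -[RHS]pull_id; congr (pull _ _).
  by apply: pair_ext; rewrite /= !comp_idr ?pr1_pair ?pr2_pair.
by rewrite interp_rel_app1 /= !comp_idr.
Qed.

(** The equation behind this is that the formula quantifying the first variable
    of R_g (x, y) has the value of the atomic formula of alle g in C. *)
Lemma model_fun_all (a b : C) (g : LL (prd a b))
    (k : LL (prd (model_fun a) (model_fun b))) :
  pull (comparison model_fun a b) k = (model_nat (prd a b) : cla_hom _ _) g ->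
  alle k = (model_nat b : cla_hom _ _) (alle g).
Proof.
rewrite -[RHS in _ = RHS -> _]elt_pair => /(pull_iso_inj (@model_fun_prd a b)) ->.
pose r := @CanonicalRel R C (ccat (cone a) (cone b)) g.
pose phi : @formula R canL (cone b) :=
  @fall R canL (cone a) (cone b)
    (@frel R canL (ccat (cone a) (cone b)) r (fun q => tvar q)).
have E (N : metric_logical_category R) (o : C -> N) (y : LL (prd (o a) (o b))) :
    pull (pairm (comp (idm (o a)) (pr1 (o a) (o b)))
                (comp (idm (o b)) (pr2 (o a) (o b)))) y = y.
  by rewrite -[pairm _ _]/(prdm _ _) prdm_id pull_id.
have : interp M phi = interp M (rel_app (alle g) (var1 b)).
  by apply: model_eq; rewrite interp_rel_app1 /= (E C id).
by rewrite interp_rel_app1 /= (E D (str_ob M)).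
Qed.

Lemma model_fun_dist (a : C) :
  pull (comparison model_fun a a) (mlc_dist (model_fun a)) =
  (model_nat (prd a a) : cla_hom _ _) (mlc_dist a).
Proof. by rewrite -[RHS]elt_pair md_dist. Qed.

Definition functor_of_model : logical_functor C D :=
  {| lf_fun := model_fun; lf_one := model_fun_one; lf_prd := model_fun_prd;
     lf_nat := model_nat; lf_all := model_fun_all; lf_dist := model_fun_dist |}.

End FunctorOfModel.

(** * Elementary maps are logical transformations *)

Lemma pull_natural (R : realType) (C D : metric_logical_category R)
    (I J : functor C D) (eta : nat_trans I J)
    (a b : opp_cat C) (f : hom a b) :
  comp (pull (eta b) : @hom (CLA R) _ _)
    (fmap (functor_comp (sc_L D) (functor_opp J)) f) =
  comp (fmap (functor_comp (sc_L D) (functor_opp I)) f)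
    (pull (eta a) : @hom (CLA R) _ _).
Proof.
apply: cla_hom_ext => x; apply: etrans (esym (pull_comp _ _ _)) _.
by apply: etrans (pull_comp _ _ _); rewrite (naturality eta f).
Qed.

Definition pull_trans (R : realType) (C D : metric_logical_category R)
    (I J : functor C D) (eta : nat_trans I J) :
    nat_trans (functor_comp (sc_L D) (functor_opp J))
              (functor_comp (sc_L D) (functor_opp I)) :=
  {| component := (fun a => pull (eta a)) : forall a : opp_cat C, @hom (CLA R)
       (functor_comp (sc_L D) (functor_opp J) a)
       (functor_comp (sc_L D) (functor_opp I) a);
     naturality := @pull_natural R C D I J eta |}.

Section TransOfElementary.
Variables (R : realType) (C D : metric_logical_category R) (M N : model C D).
Variable h : elementary_map M N.

(** Elementarity for the formula d (f x) y, evaluated at y = f x, makes the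
    distance between the two sides vanish. *)
Lemma elementary_natural (a b : C) (f : hom a b) :
  comp (h b) (mor1 M f) = comp (mor1 N f) (h a).
Proof.
apply/esym/dist_separated.
pose G : ctx C := ccat (cone a) (cone b).
pose x : @term (canonical_language C) G a :=
  @tvar (canonical_language C) G (inl tt).
pose y : @term (canonical_language C) G b :=
  @tvar (canonical_language C) G (inr tt).
have := em_elementary h (rel_app2 (mlc_dist b) (fun_app f x) y).
rewrite !interp_rel_app2 !md_dist.
move/(congr1 (pull (pairm (idm _) (mor1 M f)))); rewrite -!pull_comp /=.
rewrite !comp_idl !pairm_comp -!compA prdm_pairm !pr1_pair !pr2_pair.
by rewrite !comp_idr dist_diag.
Qed.

Let F := functor_of_model M.
Let G := functor_of_model N.

Definition elementary_eta : nat_trans F G :=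
  {| component := (fun a => h a) : forall a, hom (F a) (G a);
     naturality := elementary_natural |}.

Lemma elementary_triangle (a : C) :
  lf_nat F a = comp (pull_trans elementary_eta a) (lf_nat G a).
Proof.
apply: cla_hom_ext => x; rewrite -[LHS]interp_rel_app1.
rewrite (em_elementary h (rel_app x (var1 a))) interp_rel_app1.
exact: erefl.
Qed.

Definition trans_of_elementary : logical_trans F G :=
  {| lt_eta := elementary_eta; lt_eps := pull_trans elementary_eta;
     lt_triangle := elementary_triangle; lt_eps_eta := fun a => erefl |}.

End TransOfElementary.

Program Definition functor_of_models (R : realType)
    (C D : metric_logical_category R) : functor (Mod_star C D) (Hom_star C D) :=
  {| fob := @functor_of_model R C D : Mod_star C D -> Hom_star C D;
     fmap := fun M N h => trans_of_elementary h |}.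
Next Obligation. by move=> *; exact: logical_trans_ext. Qed.
Next Obligation. by move=> *; exact: logical_trans_ext. Qed.

(** * The model of a logical functor *)

Section ModelOfFunctor.
Variables (R : realType) (C D : metric_logical_category R).
Variable F : logical_functor C D.
Local Notation canL := (canonical_language C).
Local Notation canM := (canonical_structure C).

(** The comparison morphism of an arbitrary finite product. *)
Definition comparison_ctx (G : ctx C) :
    hom (F (ctx_ob id G)) (ctx_ob F G) :=
  ctx_tuple (o := F) (fun p => fmap F (ctx_proj id p)).

Lemma comparison_ctx_tuple (x : C) (G : ctx C)
    (h : forall p : pos G, hom x (sort_at p)) :
  comp (comparison_ctx G) (fmap F (ctx_tuple (o := id) h)) =
  ctx_tuple (o := F) (fun p => fmap F (h p)).
Proof.
rewrite ctx_tuple_comp; congr ctx_tuple.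
by apply: functional_extensionality_dep => p; rewrite -fmap_comp ctx_proj_tuple.
Qed.

Lemma comparison_ctx_cone (a : C) : comparison_ctx (cone a) = idm (F a).
Proof. exact: fmap_id. Qed.

Lemma comparison_ctx_cat (G1 G2 : ctx C) :
  comparison_ctx (ccat G1 G2) =
  comp (prdm (comparison_ctx G1) (comparison_ctx G2))
       (comparison F (ctx_ob id G1) (ctx_ob id G2)).
Proof.
rewrite prdm_pairm; apply: pair_ext; rewrite ?pr1_pair ?pr2_pair ctx_tuple_comp.
  by congr ctx_tuple; apply: functional_extensionality_dep => p; exact: fmap_comp.
by congr ctx_tuple; apply: functional_extensionality_dep => p; exact: fmap_comp.
Qed.

Lemma comparison_ctx_iso (G : ctx C) : is_iso (comparison_ctx G).
Proof.
elim: G => [|a|G1 IH1 G2 IH2].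
- exact: lf_one.
- by rewrite comparison_ctx_cone; exact: is_iso_id.
- rewrite comparison_ctx_cat; apply: is_iso_comp; last exact: lf_prd.
  exact: is_iso_prdm.
Qed.

Definition str_of_functor : structure D canL :=
  {| str_ob := (fun a => F a) : lsort canL -> D;
     str_fun := fun f : lfun canL =>
       comp (fmap F (cf_mor f)) (iso_inv (comparison_ctx_iso (cf_dom f)));
     str_rel := fun r : lrel canL =>
       pull (iso_inv (comparison_ctx_iso (cr_dom r)))
         ((lf_nat F (ctx_ob id (cr_dom r)) : cla_hom _ _) (cr_elt r)) |}.

Lemma term_mor_functor (G : ctx C) (b : C) (t : @term canL G b) :
  comp (term_mor str_of_functor t) (comparison_ctx G) = fmap F (term_mor canM t).
Proof.
elim: t => [p|f ts IH] /=; first exact: ctx_proj_tuple.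
rewrite -!compA ctx_tuple_comp fmap_comp; congr comp.
under [X in ctx_tuple X]functional_extensionality_dep do rewrite IH.
by rewrite -(comparison_ctx_tuple (G := cf_dom f)) compA iso_invK comp_idl.
Qed.

Lemma functor_natural (a b : C) (f : hom a b) (x : LL b) :
  (lf_nat F a : cla_hom _ _) (pull f x) =
  pull (fmap F f) ((lf_nat F b : cla_hom _ _) x).
Proof.
exact: (congr1 (fun k : cla_hom _ _ => k x)
  (naturality (lf_nat F) (f : @hom (opp_cat C) b a))).
Qed.

(** The condition [lf_all] handles the binary product of the quantified and the
    free variables; the comparison morphisms of these two tuples are absorbed by
    Beck-Chevalley for isomorphisms. *)
Lemma interp_functor (G : ctx C) (phi : @formula R canL G) :
  pull (comparison_ctx G) (interp str_of_functor phi) =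
  (lf_nat F (ctx_ob id G) : cla_hom _ _) (interp canM phi).
Proof.
have alleF D' G' (k : LL (prd (ctx_ob F D') (ctx_ob F G')))
    (g : LL (prd (ctx_ob id D') (ctx_ob id G'))) :
    pull (comparison_ctx (ccat D' G')) k = (lf_nat F _ : cla_hom _ _) g ->
    pull (comparison_ctx G') (alle k) = (lf_nat F _ : cla_hom _ _) (alle g).
  rewrite comparison_ctx_cat pull_comp => /lf_all <-.
  by rewrite alle_pull_iso//; exact: comparison_ctx_iso.
elim: phi => {G} [G r ts|G n u phis IH|D' G psi IH|D' G psi IH] /=.
- rewrite functor_natural -!pull_comp ctx_tuple_comp.
  under [X in ctx_tuple X]functional_extensionality_dep do rewrite term_mor_functor.
  rewrite -(comparison_ctx_tuple (G := cr_dom r)) compA iso_invK comp_idl.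
  exact: erefl.
- by rewrite !cla_hom_op; congr cla_op; apply/funext => i; exact: IH.
- exact: alleF.
- rewrite !cla_hom_op2 !cla_hom_const; congr cla_op2; apply: alleF.
  by rewrite !cla_hom_op2 !cla_hom_const; congr cla_op2.
Qed.

Lemma str_of_functor_models :
  models_theory str_of_functor (canonical_theory (C := C)).
Proof.
move=> phi phi0; apply: (pull_iso_inj (comparison_ctx_iso cnil)).
by rewrite interp_functor phi0 !cla_hom_const.
Qed.

Lemma str_of_functor_dist (a : C) :
  str_rel str_of_functor (@CanonicalRel R C (ccat (cone a) (cone a)) (mlc_dist a)) =
  mlc_dist (str_ob str_of_functor a).
Proof.
apply: (pull_iso_inj (comparison_ctx_iso (ccat (cone a) (cone a)))).
rewrite -pull_comp iso_invK pull_id -lf_dist comparison_ctx_cat.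
by rewrite !comparison_ctx_cone prdm_id comp_idl.
Qed.

Definition model_of_functor : model C D :=
  {| md_str := str_of_functor; md_models := str_of_functor_models;
     md_dist := str_of_functor_dist |}.

End ModelOfFunctor.

(** * Logical transformations are elementary maps *)

Section ElementaryOfTrans.
Variables (R : realType) (C D : metric_logical_category R).
Variables (F G : logical_functor C D) (t : logical_trans F G).

Lemma comparison_ctx_natural (K : ctx C) :
  comp (ctx_map (lt_eta t) K) (comparison_ctx F K) =
  comp (comparison_ctx G K) (lt_eta t (ctx_ob id K)).
Proof.
apply: ctx_ext => p; rewrite !compA ctx_proj_map -compA !ctx_proj_tuple.
exact: naturality.
Qed.

(** After pulling back along the comparison isomorphism, both sides are images
    of the value of phi in C, which the triangle of t identifies. *)
Lemma trans_elementary (K : ctx C) (phi : @formula R (canonical_language C) K) :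
  interp (model_of_functor F) phi =
  pull (ctx_map (lt_eta t) K) (interp (model_of_functor G) phi).
Proof.
apply: (pull_iso_inj (comparison_ctx_iso F K)).
rewrite -pull_comp comparison_ctx_natural pull_comp !interp_functor.
by rewrite (lt_triangle t) lt_eps_eta.
Qed.

Definition elementary_of_trans :
    elementary_map (model_of_functor F) (model_of_functor G) :=
  @ElementaryMap R C D (model_of_functor F) (model_of_functor G)
    (fun a => lt_eta t a) trans_elementary.

End ElementaryOfTrans.

Program Definition models_of_functors (R : realType)
    (C D : metric_logical_category R) : functor (Hom_star C D) (Mod_star C D) :=
  {| fob := @model_of_functor R C D : Hom_star C D -> Mod_star C D;
     fmap := fun F G t => elementary_of_trans t |}.
Next Obligation. by move=> *; exact: elementary_map_ext. Qed.
Next Obligation. by move=> *; exact: elementary_map_ext. Qed.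

(** * The equivalence *)

Lemma interp_ext (R : realType) (C : syntactic_category R) (L : language)
    (M : structure C L) f r G (phi : formula R G) :
  (forall i, f i = str_fun M i) -> (forall i, r i = str_rel M i) ->
  interp (Structure f r) phi = interp M phi.
Proof.
case: M f r phi => o f0 r0 f r phi /= ff rr.
have -> : f = f0 by exact: functional_extensionality_dep.
by have -> : r = r0 by exact: functional_extensionality_dep.
Qed.

Section Equivalence.
Variables (R : realType) (C D : metric_logical_category R).

Section ModelRoundTrip.
Variable M : model C D.
Let M' : model C D := model_of_functor (functor_of_model M).
Local Notation canL := (canonical_language C).

(** The projections of a product object, as unary terms: they express the symbol
    of a datum with domain A_1, ..., A_n through the product sort. *)
Definition proj_app (G : ctx C) (p : pos G) :
    @term canL (cone (ctx_ob id G)) (sort_at p) :=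
  fun_app (ctx_proj id p) (var1 (ctx_ob id G)).

Lemma proj_app_tuple (G : ctx C) :
  ctx_tuple (fun p => term_mor M (@proj_app G p)) =
  comparison_ctx (functor_of_model M) G.
Proof.
congr ctx_tuple; apply: functional_extensionality_dep => p; exact: comp_idr.
Qed.

Lemma proj_app_canonical (G : ctx C) :
  ctx_tuple (fun p => term_mor (canonical_structure C) (@proj_app G p)) = idm _.
Proof. by apply: ctx_ext => p; rewrite ctx_proj_tuple. Qed.

(** In C, and so in M, the symbol of f on a product sort equals the symbol of f
    with several arguments applied to the projections. *)
Lemma round_trip_fun (f : lfun canL) : str_fun M' f = str_fun M f.
Proof.
have : term_mor M (fun_app (cf_mor f) (var1 (ctx_ob id (cf_dom f)))) =
    term_mor M (@tapp canL _ f (@proj_app (cf_dom f))).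
  by apply: model_term; rewrite /= proj_app_canonical.
rewrite /= proj_app_tuple comp_idr -[str_fun M (CanonicalFun _)]/(mor1 M _) => ->.
by rewrite -compA iso_invKV comp_idr.
Qed.

Lemma round_trip_rel (r : lrel canL) : str_rel M' r = str_rel M r.
Proof.
apply: (pull_iso_inj (comparison_ctx_iso (functor_of_model M) (cr_dom r))).
rewrite -pull_comp iso_invK pull_id -[LHS]interp_rel_app1 -proj_app_tuple.
apply: etrans (@model_eq R C D M _ _
  (@frel R canL _ r (@proj_app (cr_dom r))) _) _; last by [].
by rewrite interp_rel_app1 /= proj_app_canonical pull_id.
Qed.

Lemma round_trip_interp (G : ctx C) (phi : @formula R canL G) :
  interp M' phi = interp M phi.
Proof.
exact: (@interp_ext R D canL M (str_fun M') (str_rel M') G phi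
  round_trip_fun round_trip_rel).
Qed.

Program Definition round_trip_from : elementary_map M' M :=
  {| em_map := fun a => idm (str_ob M a) |}.
Next Obligation. by move=> G phi; rewrite ctx_map_id pull_id round_trip_interp. Qed.

Program Definition round_trip_to : elementary_map M M' :=
  {| em_map := fun a => idm (str_ob M a) |}.
Next Obligation. by move=> G phi; rewrite ctx_map_id pull_id round_trip_interp. Qed.

End ModelRoundTrip.

Section FunctorRoundTrip.
Variable F : logical_functor C D.
Let F' : logical_functor C D := functor_of_model (model_of_functor F).

Lemma round_trip_mor (a b : C) (f : hom a b) :
  mor1 (model_of_functor F) f = fmap F f.
Proof.
rewrite -[LHS]comp_idr -(comparison_ctx_cone F a) /mor1 /=.
by rewrite -compA iso_invK comp_idr.
Qed.

Lemma round_trip_elt (a : C) (x : LL a) :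
  elt1 (model_of_functor F) x = (lf_nat F a : cla_hom _ _) x.
Proof.
rewrite -[LHS]pull_id -(comparison_ctx_cone F a) /elt1 /=.
by rewrite -pull_comp iso_invK pull_id.
Qed.

Program Definition round_trip_eta_from : nat_trans F' F :=
  {| component := fun a => idm (F a) |}.
Next Obligation.
by move=> a b f; rewrite comp_idl comp_idr; exact: round_trip_mor.
Qed.

Program Definition round_trip_eta_to : nat_trans F F' :=
  {| component := fun a => idm (F a) |}.
Next Obligation.
by move=> a b f; rewrite comp_idl comp_idr; exact/esym/round_trip_mor.
Qed.

Program Definition round_trip_trans_from : logical_trans F' F :=
  {| lt_eta := round_trip_eta_from; lt_eps := pull_trans round_trip_eta_from |}.
Next Obligation.
move=> a; apply: cla_hom_ext => x; apply: etrans (round_trip_elt x) _.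
exact: esym (pull_id _).
Qed.
Next Obligation. by []. Qed.

Program Definition round_trip_trans_to : logical_trans F F' :=
  {| lt_eta := round_trip_eta_to; lt_eps := pull_trans round_trip_eta_to |}.
Next Obligation.
move=> a; apply: cla_hom_ext => x; apply: etrans (esym (round_trip_elt x)) _.
exact: esym (pull_id _).
Qed.
Next Obligation. by []. Qed.

End FunctorRoundTrip.

Program Definition round_trip_models : nat_trans
    (functor_comp (models_of_functors C D) (functor_of_models C D))
    (functor_id (Mod_star C D)) :=
  {| component := fun M => round_trip_from M |}.
Next Obligation.
move=> M N h; apply: elementary_map_ext => a.
by apply: etrans (comp_idl _) _; exact: esym (comp_idr _).
Qed.

Program Definition round_trip_functors : nat_trans
    (functor_comp (functor_of_models C D) (models_of_functors C D))
    (functor_id (Hom_star C D)) :=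
  {| component := fun F => round_trip_trans_from F |}.
Next Obligation.
move=> F G t; apply: logical_trans_ext => a.
by apply: etrans (comp_idl _) _; exact: esym (comp_idr _).
Qed.

Theorem models_functors_equivalent :
  equivalent_categories (Mod_star C D) (Hom_star C D).
Proof.
exists (functor_of_models C D), (models_of_functors C D); split.
  exists round_trip_models => M; exists (round_trip_to M).
  by split; apply: elementary_map_ext => a; exact: comp_idl.
exists round_trip_functors => F; exists (round_trip_trans_to F).
by split; apply: logical_trans_ext => a; exact: comp_idl.
Qed.

End Equivalence.

(** * Complete theories *)

Lemma equivalent_full_subcategory (A B : category) (P : B -> Prop) :
  (forall b, P b) -> equivalent_categories A B ->
  equivalent_categories A (full_subcategory P).
Proof.
move=> PB [F [G [[s sK] [t tK]]]].
pose F' : functor A (full_subcategory P) := @Functor A (full_subcategory P)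
  (fun a => exist _ (F a) (PB (F a))) (fun a b f => fmap F f)
  (fmap_id F) (fmap_comp F).
pose G' : functor (full_subcategory P) A := @Functor (full_subcategory P) A
  (fun b => G (sval b)) (fun a b f => fmap G f)
  (fun b => fmap_id G (sval b)) (fun a b c g f => fmap_comp G g f).
exists F', G'; split.
  by exists (@NatTrans _ _ (functor_comp G' F') (functor_id A)
    (fun a => s a) (naturality s)).
by exists (@NatTrans _ _ (functor_comp F' G') (functor_id (full_subcategory P))
  (fun b => t (sval b)) (fun a b f => naturality t f)) => b; exact: tK.
Qed.

Lemma logical_functor_alle0 (R : realType) (C D : metric_logical_category R)
    (F : logical_functor C D) (a b : C) (g : LL (prd a b)) :
  (lf_nat F (prd a b) : cla_hom _ _) g = cla_const (I01_0 R) ->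
  (lf_nat F b : cla_hom _ _) (alle g) = cla_const (I01_0 R).
Proof.
move=> g0; rewrite -(@lf_all _ _ _ F a b g (cla_const (I01_0 R))).
  exact: sc_all_const.
by rewrite g0; exact: cla_hom_const.
Qed.

(** If F identifies x and y, it sends the sentence closing x -. y to 0.  This
    sentence is a constant r by completeness, and r = 0 since constants differ
    at a point of the space F(1); so x <= y, and y <= x by symmetry. *)
Lemma complete_embedding (R : realType) (C : metric_logical_category R)
    (F : logical_functor C (Met R)) : complete_mlc C -> logical_embedding F.
Proof.
move=> CC a g h gh.
suff le (x y : LL a) : (lf_nat F a : cla_hom _ _) x = (lf_nat F a : cla_hom _ _) y ->
    cla_le x y by apply: cla_le_anti; apply: le.
move=> {gh}xy; apply/cla_leP; set z := cla_op2 _ x y.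
have z0 : (lf_nat F a : cla_hom _ _) z = cla_const (I01_0 R).
  by rewrite cla_hom_op2 xy; apply/cla_leP; exact: cla_lexx.
apply: (pull_iso_inj (is_iso_pr1_one a)); rewrite cla_hom_const; apply/alle_eq0.
have [r rE] := CC (alle (pull (pr1 a (one C)) z)).
have : (lf_nat F (one C) : cla_hom _ _) (alle (pull (pr1 a (one C)) z)) =
    cla_const (I01_0 R).
  by apply: logical_functor_alle0; rewrite functor_natural z0 cla_hom_const.
rewrite rE cla_hom_const => /(congr1 (fun k : met_map _ _ => k : _ -> _)) r0.
have [u] := ms_inhabited (F (one C)).
by have /= -> := congr1 (fun k => k u) r0.
Qed.

Theorem theorem6p11 (R : realType) (C : metric_logical_category R) :
  equivalent_categories (Mod_star C (Met R)) (Hom_star C (Met R)) /\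
  (complete_mlc C ->
   equivalent_categories (Mod_star C (Met R)) (Hom_star_embedding C (Met R))).
Proof.
split; first exact: models_functors_equivalent.
move=> CC; apply: equivalent_full_subcategory.
  by move=> F; exact: complete_embedding.
exact: models_functors_equivalent.
Qed.
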